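(* Let $\mathbf{k}$ be a field of characteristic $0$, let $0\neq\lambda\in\mathbf{k}$, let $Y$ be a well-ordered set, and let $\Omega=\{\lfloor\,\rfloor_{\rm p}\}$ consist of a single unary operator. In the free commutative $\Omega$-operated algebra $\mathbf{k}\mathfrak{C}(Y)$ let $$S_{\rm rb}:=\left\{\begin{array}{l}\phi_3(u,v):=\lfloor u\rfloor_{\rm p}\lfloor v\rfloor_{\rm p}-\lfloor u\lfloor v\rfloor_{\rm p}\rfloor_{\rm p}-\lfloor\lfloor u\rfloor_{\rm p}v\rfloor_{\rm p}-\lambda\lfloor uv\rfloor_{\rm p},\\ \phi_4(u,v):=\lfloor u\rfloor_{\rm p}^2+\lambda\lfloor u\rfloor_{\rm p}\end{array}\ \Big|\ u,v\in\mathfrak{C}(Y)\right\},$$ where $\lfloor u\rfloor_{\rm p}^2:=\lfloor\lfloor u\rfloor_{\rm p}\rfloor_{\rm p}$. Then, with the monomial order $\leq_{\rm cdb}$ on $\mathfrak{C}(Y)$: (a) $S_{\rm rb}$ is a Gröbner-Shirshov basis in $\mathbf{k}\mathfrak{C}(Y)$. (b) The set $$\mathrm{Irr}(S_{\rm rb}):=\mathfrak{C}(Y)\setminus\Big\{q_1|_{\lfloor u\rfloor_{\rm p}\lfloor v\rfloor_{\rm p}},\ q_2|_{\lfloor u\rfloor_{\rm p}^2}\ \Big|\ q_1,q_2\in\mathfrak{C}^\star(Y),\ u,v\in\mathfrak{C}(Y)\Big\}$$ is a linear basis of the free commutative quasi-idempotent Rota-Baxter algebra (of weight $\lambda$) on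 $Y$.
   Context: Algebras are associative unitary $\mathbf{k}$-algebras. **Quasi-idempotent Rota-Baxter algebras.** A quasi-idempotent Rota-Baxter algebra of weight $\lambda$ is an algebra $R$ with a linear operator $P:R\to R$ such that $P^2=-\lambda P$ and $P(x)P(y)=P(xP(y))+P(P(x)y)+\lambda P(xy)$ for all $x,y\in R$. The free commutative one on $Y$ is the free object on the set $Y$ in the category of commutative quasi-idempotent Rota-Baxter algebras of weight $\lambda$. In (b), a word in $\mathfrak{C}(Y)$ is regarded as an element of this free object through the canonical homomorphism of operated algebras from $\mathbf{k}\mathfrak{C}(Y)$ (taking $\lfloor\,\rfloor_{\rm p}$ to $P$). **Free commutative $\Omega$-operated monoid and algebra.** For a set $Z$ let $C(Z)$ be the free commutative monoid on $Z$, with identity $1$. Put $\mathfrak{C}_0=C(Y)$ and $\mathfrak{C}_{k+1}=C(Y\sqcup\Omega(\mathfrak{C}_k))$, where $\Omega(\mathfrak{C}_k)=\{\lfloor u\rfloor_\omega : \lfloor\,\rfloor_\omega\in\Omega,\ u\in\mathfrak{C}_k\}$ is a set of formal symbols; there are natural embeddings $\mathfrak{C}_k\subseteq\mathfrak{C}_{k+1}$, and $\mathfrak{C}(Y)=\bigcup_{k\ge0}\mathfrak{C}_k$, so that $\mathfrak{C}(Y)=C(Y\sqcup\Omega(\mathfrak{C}(Y)))$. $\mathbf{k}\mathfrak{C}(Y)$ is the $\mathbf{k}$-space with basis $\mathfrak{C}(Y)$, with multiplication extended bilinearly and the operators $\lfloor\,\rfloor_\omega$ extended linearly. The breadth $|u|$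 of $u\in\mathfrak{C}(Y)$ is the number of factors in its expression as a product of elements of $Y\sqcup\Omega(\mathfrak{C}(Y))$ ($|1|=0$). **$\star$-words.** For a symbol $\star\notin Y$, $\mathfrak{C}^\star(Y)$ is the set of elements of $\mathfrak{C}(Y\cup\{\star\})$ in which $\star$ occurs exactly once. For $q\in\mathfrak{C}^\star(Y)$ and $s\in\mathbf{k}\mathfrak{C}(Y)$, $q|_s$ is obtained by replacing $\star$ by $s$. **The order $\leq_{\rm cdb}$.** It is defined when the operators of $\Omega$ carry labels in $\{{\rm d},{\rm p}\}$, ordered by ${\rm d}>{\rm p}$ (when only one label is present, the comparison of labels is vacuous). Elements $u\in\mathfrak{C}(Y)$ are written $$u=u_0\lfloor u_1^*\rfloor_{\alpha_1}u_1\lfloor u_2^*\rfloor_{\alpha_2}\cdots\lfloor u_r^*\rfloor_{\alpha_r}u_r,$$ with $u_0,u_1,\dots,u_r\in C(Y)$, $u_i^*\in\mathfrak{C}(Y)$, $\alpha_i\in\{{\rm d},{\rm p}\}$; $|u|_\Omega:=r$ is the $\Omega$-breadth, and $\deg_\Omega(u)$ is the number of occurrences of operators of $\Omega$ in $u$. The order is the union $\leq_{\rm cdb}:=\bigcup_{k\ge0}\leq_k$ of orders $\leq_k$ on $\mathfrak{C}_k$ defined by induction on $k$. On $\mathfrak{C}_0=C(Y)$, for $u=u_1\cdots u_r$ and $v=v_1\cdots v_s$ with all $u_i,v_j\in Y$, $\leq_0$ is the degree-lexicographic order: $u\leq_0 v$ iff $(\deg_Y(u),u_1,\dots,u_r)\leq(\deg_Y(v),v_1,\dots,v_s)$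 lexicographically, where $\deg_Y$ is the number of occurrences of letters of $Y$. Given $\leq_k$ on $\mathfrak{C}_k$, let $u,v\in\mathfrak{C}_{k+1}$ be written $u=u_0\lfloor u_1^*\rfloor_{\alpha_1}u_1\cdots\lfloor u_r^*\rfloor_{\alpha_r}u_r$ and $v=v_0\lfloor v_1^*\rfloor_{\beta_1}v_1\cdots\lfloor v_s^*\rfloor_{\beta_s}v_s$ with $u_i,v_j\in C(Y)$ and $u_i^*,v_j^*\in\mathfrak{C}_k$. Then $u\leq_{k+1}v$ iff: $\deg_\Omega(u)<\deg_\Omega(v)$; or these degrees are equal and $|u|_\Omega<|v|_\Omega$; or both the degrees and the $\Omega$-breadths are equal (so $r=s$) and, lexicographically, $$(\alpha_1,\dots,\alpha_r,u_1^*,\dots,u_r^*,u_0,u_1,\dots,u_r)\leq(\beta_1,\dots,\beta_r,v_1^*,\dots,v_r^*,v_0,v_1,\dots,v_r).$$ A monomial order on $\mathfrak{C}(Y)$ is a well order $\leq$ such that $u\leq v$ implies $q|_u\leq q|_v$ for all $u,v\in\mathfrak{C}(Y)$ and $q\in\mathfrak{C}^\star(Y)$. **Gröbner-Shirshov bases.** Given a monomial order, $\bar f$ is the leading monomial of $f\in\mathbf{k}\mathfrak{C}(Y)$; $f$ is monic if the coefficient of $\bar f$ is $1$. Let $f,g$ be distinct monic elements. If there are $\omega,\mu,\nu\in\mathfrak{C}(Y)$ with $\omega=\bar f\mu=\nu\bar g$ and $\max\{|\bar f|,|\bar g|\}<|\omega|<|\bar f|+|\bar g|$, then $(f,g)^{\mu,\nu}_\omega:=f\mu-\nu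 g$ is an intersection composition. If there are $q\in\mathfrak{C}^\star(Y)$ and $\omega\in\mathfrak{C}(Y)$ with $\omega=\bar f=q|_{\bar g}$, then $(f,g)^q_\omega:=f-q|_g$ is an including composition. An element $h$ is trivial modulo $(S,\omega)$ if $h=\sum_i c_i\,q_i|_{s_i}$ with $c_i\in\mathbf{k}$, $q_i\in\mathfrak{C}^\star(Y)$, $s_i\in S$ and $q_i|_{\overline{s_i}}<\omega$. A set $S$ of monic elements is a Gröbner-Shirshov basis if for all $f,g\in S$ all intersection and including compositions of $f$ and $g$ are trivial modulo $(S,\omega)$, for the corresponding $\omega$. *)

(* Defs.v *)
From HB Require Import structures.
From mathcomp Require Import all_boot all_order all_algebra.
From mathcomp Require Import finmap monalg.
From mathcomp Require Import boolp wochoice.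

Set Implicit Arguments.
Unset Strict Implicit.
Unset Printing Implicit Defensive.

Import Order.TTheory GRing.Theory.

Local Open Scope ring_scope.

(* [Raw [:: y1; ...; ym] [:: t1; ...; tr]] stands for
   y1 ... ym [t1] ... [tr], where [t] is the bracket of t. *)
Inductive raw (Y : Type) : Type := Raw of seq Y & seq (raw Y).

Section RawChoice.
Variable Y : Type.

Lemma raw_ind' (P : raw Y -> Prop) :
  (forall s a, foldr (fun t Q => P t /\ Q) True a -> P (Raw s a)) ->
  forall u, P u.
Proof.
move=> IH; fix rec 1 => -[s a]; apply: IH.
by elim: a => [|t a IHa] //=; split=> //; apply: rec.
Qed.

Fixpoint raw_encode (u : raw Y) : GenTree.tree Y :=
  let: Raw s a := u in
  GenTree.Node (size s) (map (@GenTree.Leaf Y) s ++ map raw_encode a).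

Fixpoint raw_decode (t : GenTree.tree Y) : raw Y :=
  match t with
  | GenTree.Leaf y => Raw [:: y] [::]
  | GenTree.Node n l =>
      Raw (pmap (fun t => if t is GenTree.Leaf y then Some y else None)
                (take n l))
          (drop n (map raw_decode l))
  end.

Lemma raw_encodeK : cancel raw_encode raw_decode.
Proof.
elim/raw_ind' => s a IHa /=; congr Raw.
  rewrite take_size_cat ?size_map //.
  by elim: s => //= y s ->.
rewrite map_cat drop_size_cat ?size_map // -map_comp.
by elim: a IHa => //= t a IHa [-> /IHa ->].
Qed.

End RawChoice.

HB.instance Definition _ (Y : eqType) :=
  Equality.copy (raw Y) (can_type (@raw_encodeK Y)).
HB.instance Definition _ (Y : choiceType) :=
  Choice.copy (raw Y) (can_type (@raw_encodeK Y)).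

(* Lexicographic comparison of two sequences of the same length, [b] being
   the answer when they are equal. *)
Definition lexle (T : eqType) (le : rel T) (b : bool) :=
  fix F (s t : seq T) : bool :=
    match s, t with
    | x :: s', y :: t' => if x == y then F s' t' else le x y
    | _, _ => b
    end.

Section RawOrder.
Variables (d : Order.disp_t) (Y : orderType d).

Fixpoint raw_deg (u : raw Y) : nat :=
  let: Raw _ a := u in sumn (map (fun t => (raw_deg t).+1) a).

Definition deglex (s t : seq Y) : bool :=
  (size s < size t)%N ||
  (size s == size t) && lexle (fun x y => x <= y)%O true s t.

(* The order cdb.  Since the monoid is commutative, the letters of a word are
   all gathered in u_0 (so that u_1 = ... = u_r = 1) and written in
   nonincreasing order, and so are its bracketed factors.  There is a single
   label, hence no comparison of labels. *)
Fixpoint raw_le (u v : raw Y) : bool :=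
  let: Raw s a := u in
  let: Raw t b := v in
  (raw_deg u < raw_deg v)%N ||
  (raw_deg u == raw_deg v) &&
  ((size a < size b)%N ||
   (size a == size b) && lexle raw_le (deglex s t) a b).

Definition raw_ge (u v : raw Y) : bool := raw_le v u.
Definition letter_ge (x y : Y) : bool := (y <= x)%O.

Fixpoint normal (u : raw Y) : bool :=
  let: Raw s a := u in
  [&& sorted letter_ge s, sorted raw_ge a & all normal a].

Lemma lexle_total (T : eqType) (le : rel T) (b1 b2 : bool) (s t : seq T) :
  b1 || b2 -> {in s, forall x y, le x y || le y x} ->
  size s = size t -> lexle le b1 s t || lexle le b2 t s.
Proof.
move=> b12; elim: s t => [|x s IHs] [|y t] //= le_tot [sz].
rewrite [y == x]eq_sym; case: eqP => _; last by apply: le_tot; rewrite inE eqxx.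
by apply: IHs => // z zs; apply: le_tot; rewrite inE zs orbT.
Qed.

Lemma lexle_anti (T : eqType) (le : rel T) (b1 b2 : bool) (s t : seq T) :
  {in s, forall x y, le x y -> le y x -> x = y} ->
  size s = size t -> lexle le b1 s t -> lexle le b2 t s ->
  [/\ s = t, b1 & b2].
Proof.
elim: s t => [|x s IHs] [|y t] //= le_anti [sz].
rewrite [y == x]eq_sym; case: eqP => [<-|nxy] le1 le2; last first.
  by case: nxy; apply: le_anti; rewrite ?inE ?eqxx.
case: (IHs t) => // [z zs|-> //].
by apply: le_anti; rewrite inE zs orbT.
Qed.

Lemma lexle_trans (T : eqType) (le : rel T) (b1 b2 b3 : bool) (s t r : seq T) :
  (b1 -> b2 -> b3) ->
  {in s, forall x y z, le x y -> le y z -> le x z} ->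
  {in s, forall x y, le x y -> le y x -> x = y} ->
  size s = size t -> size t = size r ->
  lexle le b1 s t -> lexle le b2 t r -> lexle le b3 s r.
Proof.
move=> b123; elim: s t r => [|x s IHs] [|y t] [|z r] //= le_tr le_anti [sz1] [sz2].
have {}IHs : lexle le b1 s t -> lexle le b2 t r -> lexle le b3 s r.
  by apply: IHs => // w ws; [apply: le_tr | apply: le_anti]; rewrite inE ws orbT.
have xs : x \in x :: s by rewrite inE eqxx.
case: (x =P y) => [<-|nxy]; first by case: (x =P z).
case: (y =P z) => [<-|nyz]; first by move: nxy => /eqP/negbTE ->.
case: (x =P z) => [<-|nxz]; last exact: le_tr.
by move=> l1 l2; case: nxy; apply: le_anti.
Qed.

Lemma deglex_total : total deglex.
Proof.
move=> s t; rewrite /deglex eq_sym; case: ltngtP => //= sz.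
by apply: lexle_total => // x _ y; apply: le_total.
Qed.

Lemma deglex_anti s t : deglex s t -> deglex t s -> s = t.
Proof.
rewrite /deglex eq_sym; case: ltngtP => //= sz l1 l2.
case: (lexle_anti _ sz l1 l2) => // x _ y xy yx.
by apply/eqP; rewrite eq_le xy.
Qed.

Lemma deglex_trans : transitive deglex.
Proof.
move=> t s r; rewrite /deglex.
case: (ltngtP (size s) (size t)) => //= st; case: (ltngtP (size t) (size r)) => //= tr.
- by rewrite (ltn_trans st tr).
- by rewrite -tr st.
- by rewrite st tr.
rewrite st tr ltnn eqxx /=; apply: lexle_trans => // x _ y.
  by move=> z; apply: le_trans.
by move=> xy yx; apply/eqP; rewrite eq_le xy.
Qed.

Lemma foldr_allP (P : raw Y -> Prop) a :
  foldr (fun t Q => P t /\ Q) True a -> {in a, forall t, P t}.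
Proof.
elim: a => [|t a IHa] //= [Pt Pa] x; rewrite inE => /orP[/eqP->//|].
exact: IHa.
Qed.

Lemma raw_le_total : total raw_le.
Proof.
elim/raw_ind' => s a /foldr_allP IHa [t b]; rewrite /raw_le -/raw_le.
rewrite [raw_deg (Raw t b) == _]eq_sym; case: ltngtP => //= _.
rewrite [size b == _]eq_sym; case: ltngtP => //= sz.
by apply: lexle_total => //; apply: deglex_total.
Qed.

Lemma raw_le_anti u v : raw_le u v -> raw_le v u -> u = v.
Proof.
elim/raw_ind': u v => s a /foldr_allP IHa [t b]; rewrite /raw_le -/raw_le.
rewrite [raw_deg (Raw t b) == _]eq_sym; case: ltngtP => //= _.
rewrite [size b == _]eq_sym; case: ltngtP => //= sz l1 l2.
by case: (lexle_anti IHa sz l1 l2) => -> st ts; rewrite (deglex_anti st ts).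
Qed.

Lemma raw_le_trans : transitive raw_le.
Proof.
move=> v u w; elim/raw_ind': u v w => s a /foldr_allP IHa [t b] [r c].
rewrite /raw_le -/raw_le.
move: (raw_deg _) (raw_deg _) (raw_deg _) => p n m.
case: (ltngtP m n) => //= mn; case: (ltngtP n p) => //= np.
- by rewrite (ltn_trans mn np).
- by rewrite -np mn.
- by rewrite mn np.
rewrite mn np ltnn eqxx /=.
case: (ltngtP (size a) (size b)) => //= ab; case: (ltngtP (size b) (size c)) => //= bc.
- by rewrite (ltn_trans ab bc).
- by rewrite -bc ab.
- by rewrite ab bc.
rewrite ab bc ltnn eqxx /=; apply: lexle_trans => //.
  exact: deglex_trans.
by move=> x _ y; apply: raw_le_anti.
Qed.

Lemma letter_ge_total : total letter_ge.
Proof. by move=> x y; apply: le_total. Qed.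

Lemma letter_ge_trans : transitive letter_ge.
Proof. by move=> y x z xy yz; apply: le_trans yz xy. Qed.

Lemma letter_ge_anti : antisymmetric letter_ge.
Proof. by move=> x y; rewrite /letter_ge andbC => /le_anti. Qed.

Lemma raw_ge_total : total raw_ge.
Proof. by move=> x y; apply: raw_le_total. Qed.

Lemma raw_ge_trans : transitive raw_ge.
Proof. by move=> y x z xy yz; apply: raw_le_trans yz xy. Qed.

Lemma raw_ge_anti : antisymmetric raw_ge.
Proof. by move=> x y /andP[xy yx]; apply: raw_le_anti. Qed.

End RawOrder.

(* The free commutative operated monoid C(Y): a multiset of letters and
   bracketed words is represented by its nonincreasing enumerations, so that
   Leibniz equality is equality in C(Y).  Its universal property is given by
   [raw_eval] (existence) and [word_ind] (uniqueness) below. *)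
Record word d (Y : orderType d) := Word { wval :> raw Y; _ : normal wval }.

HB.instance Definition _ d (Y : orderType d) := [isSub for @wval d Y].
HB.instance Definition _ d (Y : orderType d) := [Choice of word Y by <:].

Section Words.
Variables (d : Order.disp_t) (Y : orderType d).
Implicit Types u v w : word Y.

Definition letters u : seq Y := let: Raw s _ := wval u in s.
Definition args u : seq (raw Y) := let: Raw _ a := wval u in a.

Definition raw_mul (u v : raw Y) : raw Y :=
  let: Raw s a := u in
  let: Raw t b := v in
  Raw (sort (@letter_ge d Y) (s ++ t)) (sort (@raw_ge d Y) (a ++ b)).

Fact normal_one : normal (Raw [::] [::] : raw Y). Proof. by []. Qed.
Fact normal_letter (y : Y) : normal (Raw [:: y] [::]). Proof. by []. Qed.
Fact normal_op u : normal (Raw [::] [:: wval u]).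
Proof. by rewrite /= (valP u). Qed.
Fact normal_mul u v : normal (raw_mul u v).
Proof.
case: u v => [[s a] /= /and3P[_ _ na]] [[t b] /= /and3P[_ _ nb]].
have st := @raw_ge_total d Y; have lt := @letter_ge_total d Y.
by rewrite !sort_sorted //= all_sort all_cat na.
Qed.

Definition wone : word Y := Word normal_one.
Definition wletter (y : Y) : word Y := Word (normal_letter y).
Definition wop u : word Y := Word (normal_op u).
Definition wmul u v : word Y := Word (normal_mul u v).

Definition breadth u : nat := (size (letters u) + size (args u))%N.
Definition cdb_le u v : bool := raw_le u v.

Lemma letter_sortP (s t : seq Y) :
  reflect (sort (@letter_ge d Y) s = sort (@letter_ge d Y) t) (perm_eq s t).
Proof.
exact: (perm_sortP (@letter_ge_total d Y) (@letter_ge_trans d Y)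
                   (@letter_ge_anti d Y)).
Qed.

Lemma raw_sortP (s t : seq (raw Y)) :
  reflect (sort (@raw_ge d Y) s = sort (@raw_ge d Y) t) (perm_eq s t).
Proof.
exact: (perm_sortP (@raw_ge_total d Y) (@raw_ge_trans d Y) (@raw_ge_anti d Y)).
Qed.

Lemma wmulC : commutative wmul.
Proof.
case=> [[s a] na] [[t b] nb]; apply: val_inj => /=.
by congr Raw; [apply/letter_sortP | apply/raw_sortP]; rewrite perm_catC.
Qed.

Lemma wmul1m : left_id wone wmul.
Proof.
case=> [[s a] na]; apply: val_inj => /=.
case/and3P: na => ns na _; congr Raw; apply: sorted_sort => //.
  exact: letter_ge_trans.
exact: raw_ge_trans.
Qed.

Lemma wmulm1 : right_id wone wmul.
Proof. by move=> u; rewrite wmulC wmul1m. Qed.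

Lemma wmulA : associative wmul.
Proof.
case=> [[s a] na] [[t b] nb] [[r c] nc]; apply: val_inj => /=.
have perm_l (T : eqType) (x y z : seq T) le :
    perm_eq (x ++ sort le (y ++ z)) (sort le (x ++ y) ++ z).
  apply: (@perm_trans _ (x ++ (y ++ z))); first by rewrite perm_cat2l perm_sort.
  by rewrite catA perm_cat2r perm_sym perm_sort.
by congr Raw; [apply/letter_sortP | apply/raw_sortP].
Qed.

Lemma wunitm u v : wmul u v = wone -> u = wone /\ v = wone.
Proof.
have sort0 (T : eqType) (le : rel T) (x y : seq T) :
    sort le (x ++ y) = [::] -> x = [::] /\ y = [::].
  move/(congr1 size); rewrite size_sort size_cat => /eqP.
  by rewrite addn_eq0 => /andP[/nilP-> /nilP->].
case: u v => [[s a] na] [[t b] nb] /(congr1 val) /= [] /sort0[s0 t0] /sort0[a0 b0].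
by split; apply: val_inj => /=; rewrite ?s0 ?a0 ?t0 ?b0.
Qed.

HB.instance Definition _ := Choice_isMonomialDef.Build (word Y)
  wmulA wmul1m wmulm1 wunitm.
HB.instance Definition _ := MonomialDef_isConomialDef.Build (word Y) wmulC.

End Words.

(* The homomorphism of commutative operated monoids from the words to
   (M, mul, one, P) that extends f : Y -> M. *)
Section Eval.
Variables (Y M : Type) (mul : M -> M -> M) (one : M) (P : M -> M) (f : Y -> M).

Fixpoint raw_eval (u : raw Y) : M :=
  let: Raw s a := u in
  foldr mul one (map f s ++ map (fun t => P (raw_eval t)) a).

End Eval.

Lemma raw_eval_morph (Y M N : Type) (mul : M -> M -> M) (mul' : N -> N -> N)
    one one' (P : M -> M) (P' : N -> N) (f : Y -> M) (g : Y -> N) (h : M -> N) u :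
  h one = one' -> (forall x y, h (mul x y) = mul' (h x) (h y)) ->
  (forall x, h (P x) = P' (h x)) -> (forall y, h (f y) = g y) ->
  h (raw_eval mul one P f u) = raw_eval mul' one' P' g u.
Proof.
move=> h1 hM hP hf; elim/raw_ind': u => s a /=.
elim: s => [|y s IHs] /= IHa; last by rewrite hM hf IHs.
by elim: a IHa => //= t a IHa [ht /IHa hts]; rewrite hM hP ht hts.
Qed.

Section EvalTheory.
Variables (d : Order.disp_t) (Y : orderType d).
Variables (M : Type) (mul : M -> M -> M) (one : M) (P : M -> M) (f : Y -> M).
Hypotheses (mulA : associative mul) (mulC : commutative mul).
Hypothesis (mul1 : left_id one mul).

Let ev (u : word Y) := raw_eval mul one P f u.

Lemma raw_eval_one : ev (wone Y) = one.
Proof. by []. Qed.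

Lemma raw_eval_letter y : ev (wletter y) = f y.
Proof. by rewrite /ev /= mulC mul1. Qed.

Lemma raw_eval_op u : ev (wop u) = P (ev u).
Proof. by rewrite /ev /= mulC mul1. Qed.

Lemma foldr_mul_cat s t :
  foldr mul one (s ++ t) = mul (foldr mul one s) (foldr mul one t).
Proof. by elim: s => [|x s IHs] /=; rewrite ?mul1 // IHs mulA. Qed.

Lemma foldr_mul_perm (T : eqType) (g : T -> M) s t : perm_eq s t ->
  foldr mul one (map g s) = foldr mul one (map g t).
Proof.
elim: s t => [|x s IHs] t; first by rewrite perm_sym => /perm_nilP ->.
move=> pst; have /rot_to[i r tE] : x \in t by rewrite -(perm_mem pst) inE eqxx.
have prt : perm_eq t (x :: r) by rewrite -tE perm_sym perm_rot.
have /IHs psr : perm_eq s r by rewrite -(perm_cons x) (perm_trans pst).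
rewrite /= psr -[LHS]/(foldr mul one (map g (x :: r))) -tE /rot map_cat.
by rewrite foldr_mul_cat mulC -foldr_mul_cat -map_cat cat_take_drop.
Qed.

Lemma raw_eval_mul u v : ev (wmul u v) = mul (ev u) (ev v).
Proof.
case: u v => [[s a] na] [[t b] nb]; rewrite /ev /= !foldr_mul_cat.
rewrite !(@foldr_mul_perm _ _ (sort _ _) _ (permEl (perm_sort _ _))).
rewrite !map_cat !foldr_mul_cat.
rewrite -!mulA; congr mul; rewrite !mulA; congr mul; exact: mulC.
Qed.

End EvalTheory.

Section EvalUnique.
Variables (d : Order.disp_t) (Y : orderType d).

Lemma word_ind (Q : word Y -> Prop) :
  Q (wone Y) -> (forall y u, Q u -> Q (wmul (wletter y) u)) ->
  (forall u v, Q u -> Q v -> Q (wmul (wop u) v)) -> forall u, Q u.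
Proof.
move=> Q1 Ql Qo [u nu].
elim/raw_ind': u nu => s a /foldr_allP IHa nu.
have Qa b : {subset b <= a} -> forall nb, Q (@Word _ Y (Raw [::] b) nb).
  elim: b => [|t b IHb] bs nb; first by rewrite (_ : Word _ = wone Y) //; apply: val_inj.
  have ta : t \in a by apply: bs; rewrite inE eqxx.
  have nt : normal t by case/and3P: nb => _ _ /andP[].
  have nb' : normal (Raw [::] b : raw Y).
    by case/and3P: (nb) => _ /path_sorted sb /andP[_ nb']; rewrite /= sb.
  have {IHb}Qb : Q (Word nb').
    by apply: IHb => x xb; apply: bs; rewrite inE xb orbT.
  have := Qo _ _ (IHa t ta nt) Qb; congr Q; apply: val_inj => /=; congr Raw.
  by apply: sorted_sort; [exact: raw_ge_trans | case/and3P: nb].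
have Qs r : forall nr, Q (@Word _ Y (Raw r a) nr).
  elim: r => [|y r IHr] nr; first exact: Qa.
  have nr' : normal (Raw r a).
    by case/and3P: (nr) => /path_sorted sr sa na; apply/and3P.
  have := Ql y _ (IHr nr'); congr Q; apply: val_inj => /=; congr Raw.
    by apply: sorted_sort; [exact: letter_ge_trans | case/and3P: nr].
  by apply: sorted_sort; [exact: raw_ge_trans | case/and3P: nr].
exact: Qs.
Qed.

End EvalUnique.

Definition starred (Y : Type) := option Y.

(* The position of the star in the order of the letters only serves to choose
   sorted representatives. *)
Section StarredOrder.
Variables (d : Order.disp_t) (Y : orderType d).
HB.instance Definition _ := Choice.on (starred Y).
Definition starred_le (x y : starred Y) : bool :=
  match x, y with
  | None, _ => true
  | Some _, None => false
  | Some a, Some b => (a <= b)%O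
  end.
Fact starred_le_refl : reflexive starred_le.
Proof. by case=> //= x. Qed.
Fact starred_le_anti : antisymmetric starred_le.
Proof. by case=> [x|] [y|] //= /le_anti ->. Qed.
Fact starred_le_trans : transitive starred_le.
Proof. by case=> [y|] [x|] [z|] //=; apply: le_trans. Qed.
Fact starred_le_total : total starred_le.
Proof. by case=> [x|] [y|] //=; apply: le_total. Qed.
HB.instance Definition _ := Order.Le_isPOrder.Build d (starred Y)
  starred_le_refl starred_le_anti starred_le_trans.
HB.instance Definition _ :=
  Order.POrder_isTotal.Build d (starred Y) starred_le_total.
End StarredOrder.

Fixpoint raw_occ (T : eqType) (x : T) (u : raw T) : nat :=
  let: Raw s a := u in (count_mem x s + sumn (map (raw_occ x) a))%N.

Section OperatedAlgebra.
Variables (k : fieldType) (d : Order.disp_t) (Y : orderType d).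
Local Notation W := (word Y).
Local Notation A := {malg k[word Y]}.

(* The linear extension of the bracket to k C(Y) = {malg k[word Y]} *)
Definition kop (f : A) : A := \sum_(w <- msupp f) << f@_w *g wop w >>.

Lemma kopEw (D : {fset W}) (f : A) : (msupp f `<=` D)%fset ->
  kop f = \sum_(w <- D) << f@_w *g wop w >>.
Proof.
move=> fD; rewrite /kop (big_fset_incl _ fD) // => w _ /mcoeff_outdom ->.
by rewrite monalgU0.
Qed.

Fact kop_is_linear : linear kop.
Proof.
move=> c f g; pose D := (msupp f `|` msupp g)%fset.
have fD : (msupp f `<=` D)%fset by apply: fsubsetUl.
have gD : (msupp g `<=` D)%fset by apply: fsubsetUr.
have cD : (msupp (c *: f + g) `<=` D)%fset.
  apply: fsubset_trans (msuppD_le _ _) _; rewrite fsubUset gD andbT.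
  exact: fsubset_trans (msuppZ_le _ _) fD.
rewrite (kopEw fD) (kopEw gD) (kopEw cD) scaler_sumr -big_split /=.
apply: eq_bigr => w _; rewrite mcoeffD mcoeffZ monalgUD; congr (_ + _).
by apply/malgP => v; rewrite mcoeffU mcoeffZ mcoeffU mulrnAr.
Qed.
HB.instance Definition _ :=
  GRing.isLinear.Build k A A *:%R kop kop_is_linear.

Lemma kopU c w : kop << c *g w >> = << c *g wop w >>.
Proof. by rewrite (kopEw msuppU_le) big_seq_fset1 mcoeffUU. Qed.

(* The star is [None]. *)
Definition is_starword (q : word (starred Y)) : bool :=
  raw_occ None (wval q) == 1%N.

(* q|_u for a word u, and q|_s for an element s of k C(Y) *)
Definition wsubst (q : word (starred Y)) (u : W) : W :=
  raw_eval (@wmul d Y) (wone Y) (@wop d Y)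
    (fun x => if x is Some y then wletter y else u) q.

Definition ksubst (q : word (starred Y)) (s : A) : A :=
  raw_eval *%R 1 kop (fun x => if x is Some y then << wletter y >> else s) q.

Lemma ksubstU q u : ksubst q << u >> = << wsubst q u >>.
Proof.
rewrite /ksubst /wsubst; symmetry.
apply: (raw_eval_morph (h := fun w : W => << w >> : A)) => //.
- by move=> v w; rewrite malgM_def fgmulUU mulr1.
- by move=> w; rewrite kopU.
by case.
Qed.

End OperatedAlgebra.

Section GroebnerShirshov.
Variables (k : fieldType) (d : Order.disp_t) (Y : orderType d).
Variable le : rel (word Y).
Local Notation W := (word Y).
Local Notation A := {malg k[word Y]}.

Definition monomial_order : Prop :=
  well_order le /\
  forall (q : word (starred Y)) (u v : W),
    is_starword q -> le u v -> le (wsubst q u) (wsubst q v).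

(* Leading monomial (junk value 1 on the zero element) *)
Definition lead (f : A) : W :=
  head (wone Y) (sort (fun u v => le v u) (msupp f)).

Definition is_monic (f : A) : Prop := f@_(lead f) = 1.

Definition trivial_mod (S : A -> Prop) (w : W) (h : A) : Prop :=
  exists ts : seq (k * word (starred Y) * A),
    (forall c q s, (c, q, s) \in ts ->
       [/\ is_starword q, S s, le (wsubst q (lead s)) w
         & wsubst q (lead s) != w]) /\
    h = \sum_(t <- ts) t.1.1 *: ksubst t.1.2 t.2.

Definition intersection_trivial (S : A -> Prop) (f g : A) : Prop :=
  forall w mu nu : W,
    w = wmul (lead f) mu -> w = wmul nu (lead g) ->
    (maxn (breadth (lead f)) (breadth (lead g)) < breadth w)%N ->
    (breadth w < breadth (lead f) + breadth (lead g))%N ->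
    trivial_mod S w (f * << mu >> - << nu >> * g).

Definition including_trivial (S : A -> Prop) (f g : A) : Prop :=
  forall (w : W) (q : word (starred Y)), is_starword q ->
    w = lead f -> w = wsubst q (lead g) ->
    trivial_mod S w (f - ksubst q g).

Definition GS_basis (S : A -> Prop) : Prop :=
  (forall f, S f -> is_monic f) /\
  (forall f g, S f -> S g -> f <> g ->
     intersection_trivial S f g /\ including_trivial S f g).

End GroebnerShirshov.

Section RotaBaxter.
Variables (k : fieldType) (lam : k).

Definition qiRB (R : comAlgType k) (P : {linear R -> R}) : Prop :=
  (forall x, P (P x) = - lam *: P x) /\
  (forall x y, P x * P y = P (x * P y) + P (P x * y) + lam *: P (x * y)).

Definition extends_hom (Y : Type) (R R' : comAlgType k)
    (P : {linear R -> R}) (P' : {linear R' -> R'})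
    (i : Y -> R) (j : Y -> R') (h : {lrmorphism R -> R'}) : Prop :=
  (forall y, h (i y) = j y) /\ (forall x, h (P x) = P' (h x)).

(* MathComp algebras satisfy 1 <> 0; the zero algebra would add no condition,
   as every algebra has exactly one homomorphism to it. *)
Definition free_qiRB (Y : Type) (F : comAlgType k) (P : {linear F -> F})
    (i : Y -> F) : Prop :=
  qiRB P /\
  forall (R : comAlgType k) (PR : {linear R -> R}) (j : Y -> R), qiRB PR ->
    exists h : {lrmorphism F -> R},
      extends_hom P PR i j h /\
      forall h' : {lrmorphism F -> R}, extends_hom P PR i j h' -> h' =1 h.

End RotaBaxter.

Definition linear_basis (k : fieldType) (V : lmodType k) (I : eqType)
    (B : I -> Prop) (b : I -> V) : Prop :=
  (forall (s : seq I) (c : I -> k), uniq s -> (forall x, x \in s -> B x) ->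
     \sum_(x <- s) c x *: b x = 0 -> forall x, x \in s -> c x = 0) /\
  (forall v : V, exists (s : seq I) (c : I -> k),
     (forall x, x \in s -> B x) /\ v = \sum_(x <- s) c x *: b x).

Section Srb.
Variables (k : fieldType) (lam : k) (d : Order.disp_t) (Y : orderType d).
Local Notation W := (word Y).
Local Notation A := {malg k[word Y]}.

Definition phi3 (u v : W) : A :=
  << wmul (wop u) (wop v) >> - << wop (wmul u (wop v)) >>
  - << wop (wmul (wop u) v) >> - lam *: << wop (wmul u v) >>.

Definition phi4 (u : W) : A := << wop (wop u) >> + lam *: << wop u >>.

Definition S_rb (f : A) : Prop :=
  (exists u v, f = phi3 u v) \/ (exists u, f = phi4 u).

Definition Irr_rb (w : W) : Prop :=
  ~ (exists q u v, is_starword q /\ w = wsubst q (wmul (wop u) (wop v))) /\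
  ~ (exists q u, is_starword q /\ w = wsubst q (wop (wop u))).

(* The homomorphism of operated algebras from k C(Y) to (F, P) extending i *)
Definition canonical_hom (F : comAlgType k) (P : {linear F -> F}) (i : Y -> F)
    (f : A) : F :=
  \sum_(w <- msupp f) f@_w *: raw_eval *%R 1 P i w.

Lemma canonical_homU (F : comAlgType k) (P : {linear F -> F}) (i : Y -> F) (w : W) :
  canonical_hom P i << w >> = raw_eval *%R 1 P i w.
Proof. by rewrite /canonical_hom msuppU1 big_seq_fset1 mcoeffUU scale1r. Qed.

End Srb.

(* Main.v *)
(* Part (a): the only compositions that are not formally trivial are
   ([u][v][x]; phi3(u,v), phi3(v,x)) and ([[u]][v]; phi3([u],v), phi4(u)); both
   reduce to zero by identities valid for any linear operator on a commutative
   algebra ([rb_defect_triple], [rb_defect_op]).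

   Part (b): the span of the irreducible words is stable under the product, by
   induction on the degree, because the Rota-Baxter relation lowers the degree of
   the factors to be multiplied.  For linear independence no rewriting is needed:
   if an algebra is a direct sum of two nonunital subalgebras, [- lam] times a
   projection is a quasi-idempotent Rota-Baxter operator.  Applied to signals with
   jumps, decomposed into a continuous part and a part that is constant between
   the jumps, this turns an irreducible word [s0 [s1 [... [sn]]]] into the
   quasi-symmetric sum of the products s1(i1) ... sn(in) over i1 > ... > in, in
   which every word is recognized by one of its monomials.  A boolean parameter,
   choosing to which subalgebra the constants belong, detects a final [1]. *)
Require Import Defs.
From HB Require Import structures.
From mathcomp Require Import all_boot all_order all_algebra.
From mathcomp Require Import finmap monalg.
From mathcomp Require Import generic_quotient ring_quotient.
From mathcomp Require Import boolp wochoice ring zify.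

Set Implicit Arguments.
Unset Strict Implicit.
Unset Printing Implicit Defensive.

Import Order.TTheory GRing.Theory.

Local Open Scope ring_scope.

(** The strict summation [f |-> lam * sum of f(i) over i < n] is a Rota-Baxter operator of weight
    [lam] whose iterates separate words, but it violates [P^2 = - lam P]. The two sides of an
    instant reconcile both properties. A letter vanishes to the left of every instant, so the
    continuous part of a word containing an outer letter is minus the sum of its earlier right-hand
    values, and [- lam] times it is the strict summation. The result is continuous, hence merely
    rescaled by a second application of [P]. Multiplying by a letter restores the zeros on the left;
    since in an irreducible word every bracket whose argument is not [1] encloses an outer letter,
    its nested brackets become nested strict sums. In (a), when the leading word of [g] lies inside
    an argument of [f], linearity of the relation in that argument allows it to be replaced by the
    lower terms of [g]. A difficulty of another kind is the order: words are sorted representatives,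
    so a product sorts again, and lexicographic comparison has to survive this. *)

(** * Lexicographic comparison of sorted sequences *)

Section LexInsert.
Variables (T : eqType) (le : rel T).
Hypotheses (le_total : total le) (le_trans : transitive le)
  (le_anti : forall x y, le x y -> le y x -> x = y).

Let ge := fun x y => le y x.

Fixpoint insert (x : T) (s : seq T) : seq T :=
  if s is y :: s' then if ge x y then x :: s else y :: insert x s' else [:: x].

Let le_refl : reflexive le. Proof. by move=> x; have := le_total x x; rewrite orbb. Qed.
Let ge_total : total ge. Proof. by move=> x y; apply: le_total. Qed.
Let ge_trans : transitive ge. Proof. by move=> y x z /[swap]; apply: le_trans. Qed.
Let ge_anti : antisymmetric ge.
Proof. by move=> x y /andP[xy yx]; apply: le_anti. Qed.

Lemma perm_insert x s : perm_eq (insert x s) (x :: s).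
Proof.
elim: s => //= y s IHs; case: ifP => // _.
rewrite -(perm_cons y) in IHs; apply: (perm_trans IHs).
exact: (permEl (perm_catCA [:: y] [:: x] s)).
Qed.

Lemma insert_sorted x s : sorted ge s -> sorted ge (insert x s).
Proof.
elim: s => //= y s IHs ys; case: ifP => [/= ->//|/negbT xy].
have yx : ge y x by case/orP: (ge_total x y) => // h; rewrite h in xy.
rewrite /= path_sortedE // IHs ?(path_sorted ys) // andbT.
rewrite (perm_all _ (perm_insert _ _)) /= yx.
by move: ys; rewrite path_sortedE // => /andP[].
Qed.

Lemma sort_cons x s : sort ge (x :: s) = insert x (sort ge s).
Proof.
apply: (sorted_eq ge_trans ge_anti); first exact: sort_sorted.
  exact/insert_sorted/sort_sorted.
by rewrite perm_sort perm_sym (perm_trans (perm_insert _ _)) // perm_cons perm_sort.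
Qed.

Lemma lexle_weaken (b1 b2 : bool) (s t : seq T) : size s = size t ->
  (b1 -> b2) -> lexle le b1 s t -> lexle le b2 s t.
Proof.
by move=> + b12; elim: s t => [|x s IHs] [|y t] //= [/IHs]; case: eqP.
Qed.

(** Before the first difference, [x] enters both sequences at the same place. At the difference it
    lands before both entries, behind both, or before only one of them; in the last case totality or
    transitivity compares the new entries. *)
Lemma lexle_insert (b1 b2 : bool) x (s t : seq T) : size s = size t ->
  (b1 -> b2) -> lexle le b1 s t -> lexle le b2 (insert x s) (insert x t).
Proof.
move=> + b12; elim: s t => [|y s IHs] [|z t] //= => [_|[sz]].
  by rewrite eqxx.
case: (y =P z) => [<-|yz le_yz].
  case: ifP => /= _; rewrite !eqxx => ?; last exact: IHs.
  exact: lexle_weaken sz b12 _.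
case: ifP => xy; case: ifP => xz /=; rewrite ?eqxx.
- by move/eqP/negbTE: yz ->.
- case: eqP => [xEz|_]; first by rewrite -xEz /ge le_refl in xz.
  by have := le_total x z; rewrite -/(ge x z) xz orbF.
- case: eqP => [yEx|_]; first by rewrite yEx /ge le_refl in xy.
  by apply: le_trans le_yz xz.
by move/eqP/negbTE: yz ->.
Qed.

(** This makes the order compatible with products. Two separate answers on ties are needed because
    the letters, which decide between words with equal brackets, are multiplied at the same time. *)
Lemma lexle_sort_cat (b1 b2 : bool) r (s t : seq T) : size s = size t ->
  sorted ge s -> sorted ge t ->
  (b1 -> b2) -> lexle le b1 s t -> lexle le b2 (sort ge (r ++ s)) (sort ge (r ++ t)).
Proof.
move=> st ss tt; elim: r b2 => [|x r IHr] b2 b12 lst /=.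
  by rewrite !sorted_sort //; apply: lexle_weaken lst.
by rewrite !sort_cons; apply: (@lexle_insert b2) => //;
  rewrite ?size_sort ?size_cat ?st ?IHr.
Qed.
End LexInsert.

(** * Minima for lexicographic orders *)

Section LexMin.
Variables (T U : Type).

(** [D] delimits the entries among which minima are already known to exist; [raw_min] takes words of
    bounded degree, which allows an induction. The component in [U] breaks ties. *)
Lemma lex_min (E : eqType) (le : rel E) (D : E -> Prop) (leU : rel U) :
  reflexive leU ->
  (forall X : E -> Prop, (exists2 x, X x & D x) ->
     exists m, [/\ X m, D m & forall x, X x -> D x -> le m x]) ->
  (forall X : U -> Prop, (exists x, X x) -> exists2 m, X m & forall x, X x -> leU m x) ->
  forall (n : nat) (X : seq E * U -> Prop),
  (forall p, X p -> size p.1 = n /\ {in p.1, forall x, D x}) -> (exists p, X p) ->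
  exists2 m, X m & forall p, X p -> lexle le (leU m.2 p.2) m.1 p.1.
Proof.
move=> leUxx minE minU; elim=> [|n IHn] X XD [[s0 u0] Xp0].
  have [|m Xm mP] := minU (fun u => X ([::], u)).
    by case: s0 Xp0 => [|x s0] Xp; [exists u0 | case: (XD _ Xp)].
  exists ([::], m) => //= -[s u] Xsu /=.
  by case: s Xsu => [|x s] Xsu; [apply: mP | case: (XD _ Xsu)].
have [|m [[s1 [u1 X1]] Dm mP]] := minE (fun x => exists s u, X (x :: s, u)).
  case: s0 Xp0 => [|x s0] Xp; first by case: (XD _ Xp).
  by exists x; [exists s0, u0 | case: (XD _ Xp) => _; apply; rewrite inE eqxx].
have [||[s u] Xsu suP] := IHn (fun p => X (m :: p.1, p.2)).
- move=> [s u] /= Xsu; case: (XD _ Xsu) => -[<-] Ds; split=> // x xs.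
  by apply: Ds; rewrite inE xs orbT.
- by exists (s1, u1).
exists (m :: s, u) => // -[[|x t] v] Xtv; first by case: (XD _ Xtv).
rewrite /=; case: eqP => [mx|_]; first by apply: (suP (t, v)); rewrite mx.
apply: mP; first by exists t, v.
by case: (XD _ Xtv) => _; apply; rewrite inE eqxx.
Qed.

Lemma measure_min (m : T -> nat) (X : T -> Prop) : (exists x, X x) ->
  exists2 x, X x & forall y, X y -> (m x <= m y)%N.
Proof.
move=> [x0 X0]; have ex : exists n, `[< exists2 x, X x & m x = n >].
  by exists (m x0); apply/asboolP; exists x0.
case: (ex_minnP ex) => n /asboolP[x Xx <-] nP; exists x => // y Xy.
by apply: nP; apply/asboolP; exists y.
Qed.
End LexMin.

(** * The order cdb is a well order compatible with products and brackets *)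

Section CdbOrder.
Variables (d : Order.disp_t) (Y : orderType d).
Implicit Types u v w p : word Y.
Local Notation W := (word Y).

Lemma raw_le_refl (u : raw Y) : raw_le u u.
Proof. by have := raw_le_total u u; rewrite orbb. Qed.

Lemma cdb_refl : reflexive (@cdb_le d Y).
Proof. by move=> u; apply: raw_le_refl. Qed.

Lemma cdb_anti : antisymmetric (@cdb_le d Y).
Proof. by move=> u v /andP[uv vu]; apply: val_inj; apply: raw_le_anti. Qed.

Lemma cdb_trans : transitive (@cdb_le d Y).
Proof. by move=> v u w; apply: raw_le_trans. Qed.

Lemma cdb_total : total (@cdb_le d Y).
Proof. by move=> u v; apply: raw_le_total. Qed.

Lemma deglex_sort_cat (r s t : seq Y) :
  sorted (@letter_ge d Y) s -> sorted (@letter_ge d Y) t -> deglex s t ->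
  deglex (sort (@letter_ge d Y) (r ++ s)) (sort (@letter_ge d Y) (r ++ t)).
Proof.
move=> ss st; rewrite /deglex !size_sort !size_cat ltn_add2l eqn_add2l.
case: ltngtP => //= sz; apply: (@lexle_sort_cat _ (fun x y : Y => (x <= y)%O)) => //.
- exact: le_total.
- exact: le_trans.
- by move=> x y xy yx; apply/eqP; rewrite eq_le xy.
Qed.

Definition deg u := raw_deg u.

Definition nargs u := size (args u).

Lemma deg_mul u v : deg (wmul u v) = (deg u + deg v)%N.
Proof.
case: u v => [[s a] nu] [[t b] nv]; rewrite /deg /= -sumn_cat -map_cat.
by apply: perm_sumn; rewrite perm_map // perm_sort.
Qed.

Lemma deg_op u : deg (wop u) = (deg u).+1.
Proof. by rewrite /deg /= addn0. Qed.

Lemma breadth_mul u v : breadth (wmul u v) = (breadth u + breadth v)%N.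
Proof.
case: u v => [[s a] nu] [[t b] nv].
by rewrite /breadth /= !size_sort !size_cat addnACA.
Qed.

Lemma cdb_mul p u v : cdb_le u v -> cdb_le (wmul p u) (wmul p v).
Proof.
have degE := deg_mul p; rewrite /cdb_le.
case: p u v degE => [[r c] np] [[s a] nu] [[t b] nv] degE.
move: (degE (Word nu)) (degE (Word nv)); rewrite /deg /= => -> ->.
rewrite !size_sort !size_cat !ltn_add2l !eqn_add2l.
case: ltngtP => //= _; case: ltngtP => //= sz.
case/and3P: nu => ss sa _; case/and3P: nv => st sb _.
apply: lexle_sort_cat => //; [exact: raw_le_total | exact: raw_le_trans |
  exact: raw_le_anti | exact: deglex_sort_cat].
Qed.

Lemma cdb_op u v : cdb_le u v -> cdb_le (wop u) (wop v).
Proof.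
move=> uv; rewrite /cdb_le /= !addn0 !ltnS.
have uv' : (raw_deg u <= raw_deg v)%N.
  by move: uv; rewrite /cdb_le; case: u v => [[s a] ?] [[t b] ?] /=; case: ltngtP.
by rewrite eqSS; case: ltngtP uv' => //= _ _; case: eqP.
Qed.

(** Cancellation upgrades compatibility of the order with products to its strict form, which
    triviality of compositions requires. *)
Lemma wmulI p : injective (wmul p).
Proof.
move=> [[s a] nu] [[t b] nv]; case: p => [[r c] np] /(congr1 val) /= [].
move=> /letter_sortP; rewrite perm_cat2l => st /raw_sortP; rewrite perm_cat2l => ab.
case/and3P: (nu) => ss sa _; case/and3P: (nv) => stt sb _.
apply: val_inj => /=; congr Raw.
  exact: (sorted_eq (@letter_ge_trans d Y) (@letter_ge_anti d Y)).
exact: (sorted_eq (@raw_ge_trans d Y) (@raw_ge_anti d Y)).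
Qed.

Lemma wop_inj : injective (@wop d Y).
Proof. by move=> u v /(congr1 val)[] /val_inj. Qed.

Definition cdb_lt u v := cdb_le u v && (u != v).

Lemma cdb_lt_mul p u v : cdb_lt u v -> cdb_lt (wmul p u) (wmul p v).
Proof. by case/andP=> uv nuv; rewrite /cdb_lt cdb_mul // (inj_eq (@wmulI p)). Qed.

Lemma cdb_lt_op u v : cdb_lt u v -> cdb_lt (wop u) (wop v).
Proof. by case/andP=> uv nuv; rewrite /cdb_lt cdb_op // (inj_eq wop_inj). Qed.

Lemma cdb_lt_deg u v : (deg u < deg v)%N -> cdb_lt u v.
Proof.
move=> uv; rewrite /cdb_lt /cdb_le; apply/andP; split.
  by case: u v uv => [[s a] ?] [[t b] ?]; rewrite /deg /= => ->.
by apply: contraTneq uv => ->; rewrite ltnn.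
Qed.

(** Nesting two juxtaposed brackets keeps the degree and lowers the number of outer brackets.
    Together with [cdb_lt_deg], this puts the lower terms of [phi3] below its leading word. *)
Lemma cdb_lt_args u v : (deg u <= deg v)%N -> (nargs u < nargs v)%N ->
  cdb_lt u v.
Proof.
move=> duv uv; rewrite /cdb_lt /cdb_le; apply/andP; split.
  move: duv uv; case: u v => [[s a] ?] [[t b] ?]; rewrite /deg /nargs /= => duv ->.
  by rewrite andbT orbC -leq_eqVlt.
by apply: contraTneq uv => ->; rewrite ltnn.
Qed.

Lemma deglex_min : well_order (fun x y : Y => (x <= y)%O) ->
  forall X : seq Y -> Prop, (exists s, X s) ->
  exists2 m, X m & forall s, X s -> deglex m s.
Proof.
move=> wo X /(measure_min size)[s0 Xs0 minsz].
have minY (Z : Y -> Prop) : (exists2 x, Z x & True) ->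
    exists m, [/\ Z m, True & forall x, Z x -> True -> (m <= x)%O].
  move=> [z Zz _]; have [|m [[/asboolP Zm mP] _]] := wo [pred x | `[< Z x >]].
    by exists z; apply/asboolP.
  by exists m; split=> // x Zx _; apply: mP; apply/asboolP.
have minU (Z : unit -> Prop) : (exists x, Z x) -> exists2 m, Z m & forall x, Z x -> true.
  by move=> [z Zz]; exists z.
pose X' (q : seq Y * unit) := X q.1 /\ size q.1 = size s0.
have X'n q : X' q -> size q.1 = size s0 /\ {in q.1, forall x, True} by case.
have exX' : exists q, X' q by exists (s0, tt).
have [[m []] [Xm szm] mP] :=
  lex_min (leU := fun _ _ => true) (fun=> isT) minY minU X'n exX'.
exists m => // s Xs; have := minsz s Xs; rewrite /= in szm.
rewrite -szm /deglex leq_eqVlt => /orP[/eqP sz|->//].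
rewrite -sz eqxx ltnn /=.
exact: (mP (s, tt) (conj Xs (etrans (esym sz) szm))).
Qed.

(** Minimize the degree, then the number of outer brackets, then the arguments and the letters by
    [lex_min]. Arguments have smaller degree than the word, so their minima come from the induction
    hypothesis. *)
Lemma raw_min : well_order (fun x y : Y => (x <= y)%O) ->
  forall X : raw Y -> Prop, (exists x, X x) ->
  exists2 m, X m & forall x, X x -> raw_le m x.
Proof.
move=> wo X exX.
have [u0 Xu0 mindeg] := measure_min (@raw_deg d Y) exX.
move: {2}(raw_deg u0).+1 (ltnSn (raw_deg u0)) => n.
elim: n X u0 {exX} Xu0 mindeg => // n IHn X u0 Xu0 mindeg degn.
pose X1 (u : raw Y) := X u /\ raw_deg u = raw_deg u0.
pose sz (u : raw Y) := let: Raw _ a := u in size a.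
have [|u1 [Xu1 du1] minsz] := @measure_min _ sz X1; first by exists u0.
have minD (Z : raw Y -> Prop) : (exists2 z, Z z & raw_deg z < n)%N ->
    exists m, [/\ Z m, (raw_deg m < n)%N &
      forall x, Z x -> (raw_deg x < n)%N -> raw_le m x].
  move=> [z Zz zn].
  have [|w [Zw wn] minw] := @measure_min _ (@raw_deg d Y)
      (fun u : raw Y => Z u /\ raw_deg u < n)%N; first by exists z.
  have [//|//|//|m [Zm mn] mP] := IHn (fun u : raw Y => Z u /\ raw_deg u < n)%N w.
  by exists m; split=> // x Zx xn; apply: mP.
pose X2 (q : seq (raw Y) * seq Y) := X1 (Raw q.2 q.1) /\ size q.1 = sz u1.
have X2n q : X2 q -> size q.1 = sz u1 /\ {in q.1, forall x, raw_deg x < n}%N.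
  case: q => [a s] /= [[_ da] sa]; split=> // x xa; rewrite -ltnS (leq_trans _ degn) //.
  rewrite ltnS -da /=; elim: (a) xa => //= t b IHb.
  rewrite inE => /orP[/eqP->|/IHb /leq_trans-> //]; last exact: leq_addl.
  exact: leq_addr.
have exX2 : exists q, X2 q.
  by case: u1 Xu1 du1 minsz @X2 X2n => [s a] Xu1 du1 _ X2 _; exists (a, s).
have deglex_refl : reflexive (@deglex d Y).
  by move=> s; have := deglex_total s s; rewrite orbb.
have [[a s] [[Xm dm] szm] mP] := lex_min deglex_refl minD (deglex_min wo) X2n exX2.
exists (Raw s a) => // -[t b] Xt; rewrite /= in szm dm mP.
have := mindeg _ Xt; rewrite -dm /= leq_eqVlt => /orP[/eqP dab|-> //].
rewrite dab ltnn eqxx /=.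
have Xt1 : X1 (Raw t b) by split=> //; rewrite -dm.
have := minsz _ Xt1; rewrite -szm /= leq_eqVlt => /orP[/eqP sab|-> //].
by rewrite sab ltnn eqxx /=; apply: (mP (b, t)); split; rewrite // -sab.
Qed.

Lemma cdb_well_order : well_order (fun x y : Y => (x <= y)%O) ->
  well_order (@cdb_le d Y).
Proof.
move=> wo; apply: antisymmetric_well_order => [|A [w0 Aw0]]; first exact: cdb_anti.
have [|m [w <- Aw] mP] := raw_min wo (X := fun u : raw Y => exists2 w : W, wval w = u & w \in A).
  by exists (wval w0), w0.
by exists w; split=> // v Av; apply: mP; exists v.
Qed.

End CdbOrder.

(** * Star-words, substitution, and factorization of words *)

Section StarWords.
Variables (d : Order.disp_t) (Y : orderType d).
Implicit Types (u v w p : word Y) (q r : word (starred Y)).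
Local Notation W := (word Y).

Definition lift u : word (starred Y) :=
  raw_eval (@wmul _ (starred Y)) (wone _) (@wop _ (starred Y))
    (fun y => wletter (Some y : starred Y)) u.

Definition star : word (starred Y) := wletter (None : starred Y).

Lemma lift_letter y : lift (wletter y) = wletter (Some y : starred Y).
Proof. exact: raw_eval_letter (@wmulC _ _) (@wmul1m _ _) _. Qed.

Lemma lift_op u : lift (wop u) = wop (lift u).
Proof. exact: raw_eval_op (@wmulC _ _) (@wmul1m _ _) _. Qed.

Lemma lift_mul u v : lift (wmul u v) = wmul (lift u) (lift v).
Proof. exact: raw_eval_mul (@wmulA _ _) (@wmulC _ _) (@wmul1m _ _) _ _. Qed.

Lemma occ_mul q r :
  raw_occ None (wmul q r) = (raw_occ None q + raw_occ None r)%N.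
Proof.
case: q r => [[s a] nq] [[t b] nr] /=.
rewrite (permP (permEl (perm_sort _ _))) count_cat addnACA; congr addn.
rewrite -sumn_cat -map_cat; apply: perm_sumn.
by rewrite perm_map // perm_sort.
Qed.

Lemma occ_op q : raw_occ None (wop q) = raw_occ None q.
Proof. by rewrite /= addn0. Qed.

Lemma occ_lift u : raw_occ None (lift u) = 0%N.
Proof.
elim/word_ind: u => [|y u IHu|u v IHu IHv] //.
  by rewrite lift_mul lift_letter occ_mul IHu.
by rewrite lift_mul lift_op occ_mul occ_op IHu IHv.
Qed.

Lemma starword_mul p q : is_starword (wmul (lift p) q) = is_starword q.
Proof. by rewrite /is_starword occ_mul occ_lift. Qed.

Lemma starword_op q : is_starword (wop q) = is_starword q.
Proof. by rewrite /is_starword occ_op. Qed.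

(** Both halves are proved in one induction: if a product contains the star once, its other factor
    is free of it and has to be recognized as a lifted word. *)
Lemma starword_cases q :
  (raw_occ None (wval q) = 0%N -> exists p, q = lift p) /\
  (is_starword q -> (exists p, q = wmul (lift p) star) \/
     exists p r, is_starword r /\ q = wmul (lift p) (wop r)).
Proof.
rewrite /is_starword; elim/word_ind: q => [|[y|] q [IH0 IH1]|q r [IHq0 IHq1] [IHr0 IHr1]].
- by split=> //; exists (wone Y).
- rewrite occ_mul /=; split=> [/IH0[p ->]|/IH1[[p ->]|[p [r [r1 ->]]]]].
  + by exists (wmul (wletter y) p); rewrite lift_mul lift_letter.
  + by left; exists (wmul (wletter y) p); rewrite lift_mul lift_letter wmulA.
  + right; exists (wmul (wletter y) p), r.
    by rewrite lift_mul lift_letter wmulA.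
- rewrite occ_mul /=; split=> // /eqP[/IH0[p ->]].
  by left; exists p; rewrite wmulC.
rewrite occ_mul occ_op; split=> [/eqP|].
  rewrite addn_eq0 => /andP[/eqP/IHq0[p ->] /eqP/IHr0[p' ->]].
  by exists (wmul (wop p) p'); rewrite lift_mul lift_op.
case: (raw_occ None (wval q) =P 0%N) => [q0|/eqP q0].
  rewrite q0 add0n => /IHr1; have [p' ->] := IHq0 q0.
  case=> [[p ->]|[p [t [t1 ->]]]].
    by left; exists (wmul (wop p') p); rewrite lift_mul lift_op wmulA.
  right; exists (wmul (wop p') p), t.
  by rewrite lift_mul lift_op wmulA.
move=> qr1; have [q1 r0] : raw_occ None (wval q) = 1%N /\ raw_occ None (wval r) = 0%N.
  by move: q0 qr1; lia.
by have [p ->] := IHr0 r0; right; exists p, q; rewrite q1 wmulC.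
Qed.

Lemma starword_ind (Q : word (starred Y) -> Prop) :
  (forall p, Q (wmul (lift p) star)) ->
  (forall p q, is_starword q -> Q q -> Q (wmul (lift p) (wop q))) ->
  forall q, is_starword q -> Q q.
Proof.
move=> Qstar Qop q; move: {2}(deg q).+1 (ltnSn (deg q)) => n.
elim: n q => // n IHn q degq /(proj2 (starword_cases q))[[p ->] //|[p [r [r1 qE]]]].
rewrite qE; apply: Qop => //; apply: IHn => //.
by move: degq; rewrite qE deg_mul deg_op addnS ltnS => /(leq_ltn_trans (leq_addl _ _)).
Qed.

Lemma wsubst_mul q r u : wsubst (wmul q r) u = wmul (wsubst q u) (wsubst r u).
Proof. exact: raw_eval_mul (@wmulA _ _) (@wmulC _ _) (@wmul1m _ _) _ _. Qed.

Lemma wsubst_op q u : wsubst (wop q) u = wop (wsubst q u).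
Proof. exact: raw_eval_op (@wmulC _ _) (@wmul1m _ _) _. Qed.

Lemma wsubst_star u : wsubst star u = u.
Proof. by rewrite /wsubst /= wmulm1. Qed.

Lemma wsubst_lift p u : wsubst (lift p) u = p.
Proof.
elim/word_ind: p => [|y p IHp|p r IHp IHr] //.
  rewrite lift_mul lift_letter wsubst_mul IHp; congr wmul.
  by rewrite /wsubst /= wmulm1.
by rewrite lift_mul lift_op wsubst_mul wsubst_op IHp IHr.
Qed.

Definition wsubstE := (wsubst_mul, wsubst_op, wsubst_star, wsubst_lift).

Lemma wsubst_le q u v : is_starword q -> cdb_le u v ->
  cdb_le (wsubst q u) (wsubst q v).
Proof.
by move=> qs uv; elim/starword_ind: q / qs => [p|p q _ IHq];
  rewrite !wsubstE cdb_mul ?cdb_op.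
Qed.

Lemma wsubst_lt q u v : is_starword q -> cdb_lt u v ->
  cdb_lt (wsubst q u) (wsubst q v).
Proof.
by move=> qs uv; elim/starword_ind: q / qs => [p|p q _ IHq];
  rewrite !wsubstE cdb_lt_mul ?cdb_lt_op.
Qed.

Lemma nargs_mul u v : nargs (wmul u v) = (nargs u + nargs v)%N.
Proof.
by case: u v => [[s a] nu] [[t b] nv]; rewrite /nargs /= size_sort size_cat.
Qed.

Lemma nargs_op u : nargs (wop u) = 1%N.
Proof. by []. Qed.

Lemma breadth_op u : breadth (wop u) = 1%N.
Proof. by []. Qed.

Lemma breadth_eq0 u : breadth u = 0%N -> u = wone Y.
Proof.
case: u => [[s a] nu] /eqP; rewrite /breadth addn_eq0 => /andP[/nilP s0 /nilP a0].
by apply: val_inj; rewrite /= -[s]/(letters (Word nu)) s0 -[a]/(args (Word nu)) a0.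
Qed.

(** Unique factorization: two distinct bracket factors of one word divide each other's cofactors.
    Coincidences between leading words are resolved by it. *)
Lemma op_factor u v p (r : W) : wmul (wop u) p = wmul (wop v) r ->
  u = v /\ p = r \/ exists t, p = wmul (wop v) t /\ r = wmul (wop u) t.
Proof.
move=> E; case: (u =P v) => [uv|uv]; first by left; split=> //; rewrite uv in E; exact: wmulI E.
right; case: p E => [[s a] np] E.
have va : wval v \in a.
  move: E; case: (r) => [[t b] nr] /(congr1 val) /= [_ /raw_sortP/perm_mem/(_ (wval v))].
  by rewrite !inE eqxx /= eq_sym => /orP[/eqP/val_inj//|].
have nt : normal (Raw s (rem (wval v) a)).
  case/and3P: (np) => ss sa na; apply/and3P; split=> //.
    exact: (subseq_sorted (@raw_ge_trans d Y) (rem_subseq _ _)).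
  by apply/allP => x /mem_rem; apply/allP.
have pE : Word np = wmul (wop v) (Word nt).
  apply: val_inj => /=; case/and3P: (np) => ss sa na; congr Raw.
    by rewrite sorted_sort //; apply: letter_ge_trans.
  rewrite -[LHS](sorted_sort (@raw_ge_trans d Y)) //.
  by apply/raw_sortP; apply: perm_to_rem.
exists (Word nt); split=> //; apply: (@wmulI _ _ (wop v)).
by rewrite -E pE wmulA (wmulC (wop u)) -wmulA.
Qed.

Lemma op_factor1 u v (r : W) : wop u = wmul (wop v) r -> u = v /\ r = wone Y.
Proof.
rewrite -{1}[wop u]wmulm1 => /op_factor[[-> <-]//|[t [/(congr1 (@breadth d Y))]]].
by rewrite breadth_mul breadth_op.
Qed.

Lemma op_factor2 u v x (r : W) : wmul (wop u) (wop v) = wmul (wop x) r ->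
  u = x /\ r = wop v \/ v = x /\ r = wop u.
Proof.
case/op_factor => [[-> <-]|[t [/op_factor1[-> ->] ->]]]; [by left|right].
by rewrite wmulm1.
Qed.

Lemma op_factor22 u v x y : wmul (wop u) (wop v) = wmul (wop x) (wop y) ->
  u = x /\ v = y \/ u = y /\ v = x.
Proof. by case/op_factor2 => [[-> /wop_inj->]|[-> /wop_inj->]]; [left|right]. Qed.

End StarWords.

(** * Two identities between the defects of the relations *)

Section RotaBaxterIdentities.
Variables (k : fieldType) (lam : k) (R : comAlgType k) (P : {linear R -> R}).
Implicit Types x y z : R.

Definition rb_defect x y :=
  P x * P y - P (x * P y) - P (P x * y) - lam *: P (x * y).

Definition qi_defect x := P (P x) + lam *: P x.

(** Scalars are turned into factors of [R], so that [ring] can handle them. *)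
Let scale_mul : exists l : R, forall x, lam *: x = l * x.
Proof. by exists lam%:A => x; rewrite mulr_algl. Qed.

(** The left-hand side compares the two ways to start reducing [P x * P y * P z]. The right-hand
    side collects the later reductions on both sides, after which the remaining terms agree. *)
Lemma rb_defect_triple x y z :
  rb_defect x y * P z - P x * rb_defect y z =
    P (rb_defect x y * z) - P (x * rb_defect y z)
    + rb_defect x (y * P z) + rb_defect x (P y * z) + lam *: rb_defect x (y * z)
    - rb_defect (x * P y) z - rb_defect (P x * y) z - lam *: rb_defect (x * y) z.
Proof.
have [l scale_mulE] := scale_mul.
rewrite /rb_defect !(mulrBl, mulrBr, =^~ scalerAl, =^~ scalerAr, scalerBr).
rewrite !(raddfB, raddfD) /= !linearZ_LR /= -?mulrA !scale_mulE.
ring.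
Qed.

(** Here the competing first steps are the product and the square in [P (P x) * P y]. *)
Lemma rb_defect_op x y :
  rb_defect (P x) y - P y * qi_defect x =
    - P (rb_defect x y) - P (qi_defect x * y) - qi_defect (x * P y)
    - qi_defect (P x * y) - lam *: qi_defect (x * y) - lam *: rb_defect x y.
Proof.
have [l scale_mulE] := scale_mul.
rewrite /rb_defect /qi_defect.
rewrite !(mulrBl, mulrBr, mulrDl, mulrDr, =^~ scalerAl, =^~ scalerAr, scalerBr, scalerDr).
rewrite !(raddfB, raddfD) /= !linearZ_LR /= -?mulrA !scale_mulE.
ring.
Qed.
End RotaBaxterIdentities.

(** * Substitution, leading words and triviality in the free operated algebra *)

Section FreeOperatedAlgebra.
Variables (k : fieldType) (d : Order.disp_t) (Y : orderType d).
Implicit Types (u v w p : word Y) (q : word (starred Y)).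
Local Notation A := {malg k[word Y]}.
Implicit Types f g : A.

Lemma malgU_one : << wone Y >> = 1 :> A.
Proof. by []. Qed.

Lemma malgU_mul u v : << wmul u v >> = << u >> * << v >> :> A.
Proof. by rewrite malgM_def fgmulUU mulr1. Qed.

Lemma malgU_scale (a : k) u : << a *g u >> = a *: << u >> :> A.
Proof. by apply/malgP => v; rewrite mcoeffU mcoeffZ mcoeffU mulrnAr mulr1. Qed.

Lemma malg_expand f : f = \sum_(w <- msupp f) f@_w *: << w >>.
Proof. by rewrite {1}[f]monalgE; apply: eq_bigr => w _; rewrite malgU_scale. Qed.

Lemma ksubst_mul (q r : word (starred Y)) f :
  ksubst (wmul q r) f = ksubst q f * ksubst r f.
Proof. exact: raw_eval_mul (@mulrA A) (@mulrC A) (@mul1r A) q r. Qed.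

Lemma ksubst_wop q f : ksubst (wop q) f = kop (ksubst q f).
Proof. exact: raw_eval_op (@mulrC A) (@mul1r A) q. Qed.

Lemma ksubst_lift p f : ksubst (lift p) f = << p >>.
Proof.
elim/word_ind: p => [|y p IHp|p r IHp IHr]; first by rewrite malgU_one.
  by rewrite lift_mul ksubst_mul IHp lift_letter [RHS]malgU_mul; congr (_ * _); apply: mulr1.
by rewrite lift_mul ksubst_mul IHr lift_op ksubst_wop IHp kopU [RHS]malgU_mul.
Qed.

Lemma ksubst_star p f : ksubst (wmul (lift p) (star Y)) f = << p >> * f.
Proof. by rewrite ksubst_mul ksubst_lift; congr (_ * _); apply: mulr1. Qed.

Lemma ksubst_op p q f :
  ksubst (wmul (lift p) (wop q)) f = << p >> * kop (ksubst q f).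
Proof. by rewrite ksubst_mul ksubst_lift ksubst_wop. Qed.

Lemma ksubst_linear q : is_starword q -> linear (@ksubst k d Y q).
Proof.
move=> qs a f g; elim/starword_ind: q / qs => [p|p q _ IHq].
  by rewrite !ksubst_star mulrDr scalerAr.
by rewrite !ksubst_op IHq linearP mulrDr scalerAr.
Qed.

Lemma ksubst_expand q f : is_starword q ->
  ksubst q f = \sum_(w <- msupp f) f@_w *: << wsubst q w >>.
Proof.
move=> qs; pose L := GRing.isLinear.Build k A A *:%R (ksubst q) (ksubst_linear qs).
pose h : {linear A -> A} := HB.pack (ksubst q) L.
rewrite -[LHS]/(h f) {1}(malg_expand f) linear_sum; apply: eq_bigr => w _.
by rewrite linearZ /= ksubstU.
Qed.

Lemma lead_eq f w : f@_w != 0 -> (forall v, v \in msupp f -> cdb_le v w) ->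
  lead (@cdb_le d Y) f = w.
Proof.
rewrite mcoeff_neq0 /lead => fw fle; set s := sort _ _.
have ws : w \in s by rewrite mem_sort.
have : sorted (fun u v => cdb_le v u) s.
  by apply: sort_sorted => u v; apply: cdb_total.
case sE : s ws => [|x t] //= ws; rewrite path_sortedE; last first.
  by move=> a b c ba cb; apply: cdb_trans cb ba.
case/andP=> /allP xt _; apply: cdb_anti; apply/andP; split.
  by apply: fle; rewrite -(mem_sort (fun u v => cdb_le v u)) -/s sE inE eqxx.
by move: ws; rewrite inE => /orP[/eqP->|/xt//]; apply: cdb_refl.
Qed.

Lemma trivial_mod0 S w : trivial_mod (@cdb_le d Y) S w (0 : A).
Proof. by exists [::]; split=> //; rewrite big_nil. Qed.

Lemma trivial_modD S w f g : trivial_mod (@cdb_le d Y) S w f ->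
  trivial_mod (@cdb_le d Y) S w g -> trivial_mod (@cdb_le d Y) S w (f + g).
Proof.
move=> [s [sP ->]] [t [tP ->]]; exists (s ++ t); split; last by rewrite big_cat.
by move=> c q h; rewrite mem_cat => /orP[/sP|/tP].
Qed.

Lemma trivial_modZ S w a f : trivial_mod (@cdb_le d Y) S w f ->
  trivial_mod (@cdb_le d Y) S w (a *: f).
Proof.
move=> [s [sP ->]]; exists [seq (a * t.1.1, t.1.2, t.2) | t <- s]; split.
  by move=> c q h /mapP[[[c' q'] h'] /sP ts [_ -> ->]].
by rewrite big_map scaler_sumr; apply: eq_bigr => t _; rewrite scalerA.
Qed.

Lemma trivial_mod_ksubst (S : A -> Prop) w q f : is_starword q -> S f ->
  cdb_lt (wsubst q (lead (@cdb_le d Y) f)) w ->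
  trivial_mod (@cdb_le d Y) S w (ksubst q f).
Proof.
move=> qs Sf /andP[le_w neq_w]; exists [:: (1, q, f)]; split.
  by move=> c r h; rewrite inE => /eqP[_ -> ->].
by rewrite big_seq1 scale1r.
Qed.

End FreeOperatedAlgebra.

(** * Triviality of the compositions, in an abstract operated algebra *)

Section Compositions.
Variables (k : fieldType) (lam : k) (d : Order.disp_t) (Y : orderType d).
Implicit Types (u v w x p : word Y) (q : word (starred Y)).
Variables (R : comAlgType k) (P : {linear R -> R}) (m : word Y -> R).
Hypotheses (m_one : m (wone Y) = 1) (m_mul : {morph m : u v / wmul u v >-> u * v})
  (m_op : {morph m : u / wop u >-> P u}).

Definition gphi3 u v : R :=
  m (wmul (wop u) (wop v)) - m (wop (wmul u (wop v)))
  - m (wop (wmul (wop u) v)) - lam *: m (wop (wmul u v)).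

Definition gphi4 u : R := m (wop (wop u)) + lam *: m (wop u).

Lemma gphi3E u v : gphi3 u v = rb_defect lam P (m u) (m v).
Proof. by rewrite /gphi3 !(m_mul, m_op). Qed.

Lemma gphi4E u : gphi4 u = qi_defect lam P (m u).
Proof. by rewrite /gphi4 !m_op. Qed.

Lemma gphi3C u v : gphi3 u v = gphi3 v u.
Proof.
rewrite /gphi3 [wmul (wop v) (wop u)]wmulC [wmul (wop v) u]wmulC.
rewrite [wmul v (wop u)]wmulC [wmul v u]wmulC; congr (_ - _); exact: addrAC.
Qed.

(** [T w f] stands for triviality of [f] modulo [w], [sub] for substitution into a star-word, and
    [G f l] for a relation [f] with leading word [l]. The compositions are computed from these
    properties alone, away from the concrete monoid algebra. *)
Variable T : word Y -> R -> Prop.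
Hypotheses (T0 : forall w, T w 0) (TD : forall w f g, T w f -> T w g -> T w (f + g))
  (TZ : forall w a f, T w f -> T w (a *: f)).
Variable sub : word (starred Y) -> R -> R.
Hypotheses (sub_star : forall f, sub (star Y) f = f)
  (sub_mul : forall p q f, sub (wmul (lift p) q) f = m p * sub q f)
  (sub_op : forall q f, sub (wop q) f = P (sub q f)).
Variable G : R -> word Y -> Prop.
Hypotheses (G3 : forall u v, G (gphi3 u v) (wmul (wop u) (wop v)))
  (G4 : forall u, G (gphi4 u) (wop (wop u)))
  (T_sub : forall q f l w, is_starword q -> G f l -> cdb_lt (wsubst q l) w ->
     T w (sub q f))
  (G_tail : forall f l, G f l -> exists2 s : seq (k * word Y),
     {in s, forall t, cdb_lt t.2 l} &
     forall q, is_starword q ->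
       m (wsubst q l) - sub q f = \sum_(t <- s) t.1 *: m (wsubst q t.2)).

Let TN w f : T w f -> T w (- f).
Proof. by rewrite -scaleN1r; apply: TZ. Qed.

Let TB w f g : T w f -> T w g -> T w (f - g).
Proof. by move=> Tf Tg; apply: TD => //; apply: TN. Qed.

Let PZ a f : P (a *: f) = a *: P f.
Proof. exact: linearZ. Qed.

Let T_sum w (s : seq (k * word Y)) (F : k * word Y -> R) :
  {in s, forall t, T w (F t)} -> T w (\sum_(t <- s) F t).
Proof.
move=> TF; rewrite big_seq; elim/big_rec: _ => // t f ts Tf.
by apply: TD => //; apply: TF.
Qed.

Let T_self w f l : G f l -> cdb_lt l w -> T w f.
Proof.
by move=> Gf lw; rewrite -(sub_star f); apply: T_sub Gf _; rewrite ?wsubstE.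
Qed.

Let T_op w f l : G f l -> cdb_lt (wop l) w -> T w (P f).
Proof.
move=> Gf lw; rewrite -[f]sub_star -sub_op.
by apply: T_sub Gf _; rewrite ?starword_op ?wsubstE.
Qed.

Let T_op_mul w p f l : G f l -> cdb_lt (wop (wmul p l)) w -> T w (P (m p * f)).
Proof.
move=> Gf lw; rewrite -[f]sub_star -sub_mul -sub_op.
by apply: T_sub Gf _; rewrite ?starword_op ?starword_mul ?wsubstE.
Qed.

Ltac smaller :=
  (apply: cdb_lt_deg; rewrite ?(deg_mul, deg_op); lia) ||
  (apply: cdb_lt_args; rewrite ?(deg_mul, deg_op, nargs_mul, nargs_op); lia).

Lemma composition33 u v x :
  T (wmul (wop u) (wmul (wop v) (wop x)))
    (gphi3 u v * m (wop x) - m (wop u) * gphi3 v x).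
Proof.
rewrite !gphi3E !m_op rb_defect_triple -!m_op -!m_mul -!gphi3E [gphi3 u v * _]mulrC.
repeat first [apply: T_op_mul (G3 _ _) _ | apply: T_self (G3 _ _) _ |
              apply: TB | apply: TD | apply: TZ]; smaller.
Qed.

Lemma composition34 u v :
  T (wmul (wop (wop u)) (wop v)) (gphi3 (wop u) v - m (wop v) * gphi4 u).
Proof.
rewrite gphi3E gphi4E !m_op rb_defect_op -!m_op -!m_mul -!gphi3E -!gphi4E.
rewrite [gphi4 u * _]mulrC.
repeat first [apply: T_op_mul (G4 _) _ | apply: T_op (G3 _ _) _ |
              apply: T_self (G4 _) _ | apply: T_self (G3 _ _) _ |
              apply: TB | apply: TN | apply: TZ]; smaller.
Qed.

Lemma composition44 u : T (wop (wop (wop u))) (gphi4 (wop u) - P (gphi4 u)).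
Proof.
rewrite /gphi4 linearD linearZ -!m_op subrr; exact: T0.
Qed.

(** The defect is linear in its first argument, and [m x] is the sum of [r] and of lower terms. The
    lower terms give smaller instances of [gphi3]; the part in [r] gives multiples of the relation
    [f], of which [P r * m (wop v)] is cancelled by the subtracted term and the others lie below the
    word of the composition. *)
Lemma composition3_nested q f l v : is_starword q -> G f l ->
  T (wmul (wop (wsubst q l)) (wop v))
    (gphi3 (wsubst q l) v - m (wop v) * P (sub q f)).
Proof.
move=> qs Gf; have [s s_lt sE] := G_tail Gf; have {}sE := sE q qs.
set x := wsubst q l in sE *; set r := sub q f in sE *.
have -> : gphi3 x v - m (wop v) * P r =
    \sum_(t <- s) t.1 *: gphi3 (wsubst q t.2) v
    - P (m (wop v) * r) - P (m v * P r) - lam *: P (m v * r).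
  have -> : \sum_(t <- s) t.1 *: gphi3 (wsubst q t.2) v = rb_defect lam P (m x - r) (m v).
    rewrite sE /rb_defect !(linear_sum, mulr_suml, scaler_sumr) -!big_split /=.
    apply: eq_bigr => t _; rewrite gphi3E /rb_defect !PZ -!scalerAl !PZ.
    by rewrite !scalerBr !scalerA [lam * _]mulrC.
  rewrite gphi3E /rb_defect !m_op !(mulrBl, linearB) /= ?scalerBr.
  rewrite [P (m v) * P r]mulrC [P (m v) * r]mulrC [m v * P r]mulrC [m v * r]mulrC.
  ring.
have subE p : P (m p * r) = sub (wop (wmul (lift p) q)) f by rewrite sub_op sub_mul.
have subE2 p : P (m p * P r) = sub (wop (wmul (lift p) (wop q))) f.
  by rewrite sub_op sub_mul sub_op.
rewrite !subE subE2; do ![apply: TB | apply: TZ].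
- apply: T_sum => t /s_lt tl; apply: TZ; apply: T_self (G3 _ _) _.
  by rewrite ![wmul _ (wop v)]wmulC cdb_lt_mul ?cdb_lt_op ?wsubst_lt.
all: apply: T_sub Gf _; rewrite ?starword_op ?starword_mul ?starword_op //.
all: rewrite !wsubstE -/x; smaller.
Qed.

Lemma composition4_nested q f l : is_starword q -> G f l ->
  T (wop (wop (wsubst q l))) (gphi4 (wsubst q l) - P (P (sub q f))).
Proof.
move=> qs Gf; have [s s_lt sE] := G_tail Gf; have {}sE := sE q qs.
set x := wsubst q l in sE *; set r := sub q f in sE *.
have -> : gphi4 x - P (P r) =
    \sum_(t <- s) t.1 *: gphi4 (wsubst q t.2) + lam *: P r.
  have -> : \sum_(t <- s) t.1 *: gphi4 (wsubst q t.2) = qi_defect lam P (m x - r).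
    rewrite sE /qi_defect !(linear_sum, scaler_sumr) -big_split /=.
    apply: eq_bigr => t _; rewrite gphi4E /qi_defect !PZ scalerDr.
    by rewrite !scalerA [lam * _]mulrC.
  rewrite gphi4E /qi_defect !linearB /= ?scalerBr.
  ring.
rewrite -sub_op; apply: TD; last apply: TZ.
  apply: T_sum => t /s_lt tl; apply: TZ; apply: T_self (G4 _) _.
  by rewrite !cdb_lt_op ?wsubst_lt.
by apply: T_sub Gf _; rewrite ?starword_op // wsubstE -/x; smaller.
Qed.

End Compositions.

(** * The relations form a Gröbner-Shirshov basis *)

Section GroebnerShirshovRB.
Variables (k : fieldType) (lam : k) (d : Order.disp_t) (Y : orderType d).
Implicit Types (u v w p : word Y) (q : word (starred Y)).
Local Notation A := {malg k[word Y]}.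
Implicit Types e f g : A.
Local Notation S := (@S_rb k lam d Y).
Local Notation lead := (lead (@cdb_le d Y)).
Local Notation phi3 := (@phi3 k lam d Y).
Local Notation phi4 := (@phi4 k lam d Y).
Local Notation triv := (trivial_mod (@cdb_le d Y) S).

Let mon w : A := << w >>.

Lemma msupp_sub_diff3 e f g (h : A) w : w \in msupp (e - (e - f - g - h)) ->
  [\/ w \in msupp f, w \in msupp g | w \in msupp h].
Proof.
have -> : e - (e - f - g - h) = f + g + h.
  by rewrite -!addrA -!opprD subKr.
move/(fsubsetP (msuppD_le _ _)); rewrite inE => /orP[|?]; last by constructor 3.
by move/(fsubsetP (msuppD_le _ _)); rewrite inE => /orP[]; [constructor 1|constructor 2].
Qed.

Lemma phi3_tail_lt u v w : w \in msupp (mon (wmul (wop u) (wop v)) - phi3 u v) ->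
  cdb_lt w (wmul (wop u) (wop v)).
Proof.
case/msupp_sub_diff3 => [||/(fsubsetP (msuppZ_le _ _))];
  rewrite msuppU1 inE => /eqP->.
- by apply: cdb_lt_args; rewrite ?(deg_mul, deg_op, nargs_mul, nargs_op); lia.
- by apply: cdb_lt_args; rewrite ?(deg_mul, deg_op, nargs_mul, nargs_op); lia.
by apply: cdb_lt_deg; rewrite ?(deg_mul, deg_op); lia.
Qed.

Lemma msupp_sub_add e f w : w \in msupp (e - (e + f)) -> w \in msupp f.
Proof. by rewrite opprD addNKr msuppN. Qed.

Lemma phi4_tail_lt u w : w \in msupp (mon (wop (wop u)) - phi4 u) ->
  cdb_lt w (wop (wop u)).
Proof.
move/msupp_sub_add/(fsubsetP (msuppZ_le _ _)); rewrite msuppU1 inE => /eqP->.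
by apply: cdb_lt_deg; rewrite !deg_op.
Qed.

Lemma lead_of_tail f w : (forall v, v \in msupp (mon w - f) -> cdb_lt v w) ->
  lead f = w /\ f@_w = 1.
Proof.
have: forall v, (mon w)@_v = (w == v)%:R by move=> v; rewrite mcoeffU1.
move: (mon w) => e eE lt_w.
have cE v : (e - f)@_v = (w == v)%:R - f@_v by rewrite mcoeffB eE.
have fw : f@_w = 1.
  have: (e - f)@_w == 0.
    apply/negPn; rewrite mcoeff_neq0; apply/negP => /lt_w.
    by rewrite /cdb_lt eqxx andbF.
  by rewrite cE eqxx subr_eq0 => /eqP.
split=> //; apply: lead_eq; first by rewrite fw oner_neq0.
move=> v fv; case: (w =P v) => [<-|/eqP nvw]; first exact: cdb_refl.
suff /lt_w/andP[] : v \in msupp (e - f) by [].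
by rewrite -mcoeff_neq0 cE (negbTE nvw) sub0r oppr_eq0 mcoeff_neq0.
Qed.

Lemma lead_phi3 u v : lead (phi3 u v) = wmul (wop u) (wop v).
Proof. by have [] := lead_of_tail (@phi3_tail_lt u v). Qed.

Lemma lead_phi4 u : lead (phi4 u) = wop (wop u).
Proof. by have [] := lead_of_tail (@phi4_tail_lt u). Qed.

Lemma S_rb_cases f : S f ->
  (exists u v, f = phi3 u v /\ lead f = wmul (wop u) (wop v)) \/
  (exists u, f = phi4 u /\ lead f = wop (wop u)).
Proof.
case=> [[u [v ->]]|[u ->]]; [left|right].
  by exists u, v; split=> //; apply: lead_phi3.
by exists u; split=> //; apply: lead_phi4.
Qed.

Lemma S_rb_tail_lt f w : S f -> w \in msupp (mon (lead f) - f) -> cdb_lt w (lead f).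
Proof.
case/S_rb_cases => [[u [v [fE lE]]]|[u [fE lE]]]; rewrite lE fE.
  exact: phi3_tail_lt.
exact: phi4_tail_lt.
Qed.

Lemma S_rb_monic f : S f -> is_monic (@cdb_le d Y) f.
Proof.
by move=> Sf; have [_] := lead_of_tail (fun w => @S_rb_tail_lt f w Sf).
Qed.

Let mon_op u : mon (wop u) = kop (mon u).
Proof. by rewrite kopU. Qed.

Let T0 w : triv w 0. Proof. exact: trivial_mod0. Qed.

Let G f w := S f /\ w = lead f.

Let G3 u v : G (phi3 u v) (wmul (wop u) (wop v)).
Proof. by split; [left; exists u, v | rewrite lead_phi3]. Qed.

Let G4 u : G (phi4 u) (wop (wop u)).
Proof. by split; [right; exists u | rewrite lead_phi4]. Qed.

Let T_sub q f l w : is_starword q -> G f l -> cdb_lt (wsubst q l) w ->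
  triv w (ksubst q f).
Proof. by move=> qs [Sf ->]; apply: trivial_mod_ksubst. Qed.

Let G_tail f l : G f l -> exists2 s : seq (k * word Y),
  {in s, forall t, cdb_lt t.2 l} &
  forall q, is_starword q ->
    mon (wsubst q l) - ksubst q f = \sum_(t <- s) t.1 *: mon (wsubst q t.2).
Proof.
case=> Sf ->; exists [seq ((mon (lead f) - f)@_w, w) | w <- msupp (mon (lead f) - f)].
  by move=> _ /mapP[w ws ->]; apply: S_rb_tail_lt.
move=> q qs; rewrite big_map -ksubst_expand // /mon -ksubstU.
have := ksubst_linear (k := k) qs (-1) f (mon (lead f)).
by rewrite !scaleN1r addrC => <-; rewrite addrC.
Qed.

Let ksubst_star1 f : ksubst (star Y) f = f.
Proof. exact: mulr1. Qed.

Let ksubst_lmul p q f : ksubst (wmul (lift p) q) f = mon p * ksubst q f.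
Proof. by rewrite ksubst_mul ksubst_lift. Qed.

Lemma phi3C u v : phi3 u v = phi3 v u.
Proof. exact: (@gphi3C k lam d Y A mon u v). Qed.

Let P : {linear (A : comAlgType k) -> (A : comAlgType k)} := @kop k d Y.

Lemma phi3_phi3_trivial u v w :
  triv (wmul (wop u) (wmul (wop v) (wop w)))
    (phi3 u v * << wop w >> - << wop u >> * phi3 v w).
Proof.
exact: (composition33 (P := P) (m := mon) (@malgU_mul k d Y) mon_op
  (@trivial_modD k d Y S) (@trivial_modZ k d Y S)
  ksubst_star1 ksubst_lmul (@ksubst_wop k d Y) G3 T_sub u v w).
Qed.

Lemma phi3_phi4_trivial u v :
  triv (wmul (wop (wop u)) (wop v)) (phi3 (wop u) v - << wop v >> * phi4 u).
Proof.
exact: (composition34 (P := P) (m := mon) (@malgU_mul k d Y) mon_op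
  (@trivial_modD k d Y S) (@trivial_modZ k d Y S)
  ksubst_star1 ksubst_lmul (@ksubst_wop k d Y) G3 G4 T_sub u v).
Qed.

Lemma phi4_phi4_trivial u :
  triv (wop (wop (wop u))) (phi4 (wop u) - kop (phi4 u)).
Proof. exact: (composition44 (P := P) (m := mon) lam mon_op T0 u). Qed.

Lemma phi3_nested_trivial q g v : is_starword q -> S g ->
  triv (wmul (wop (wsubst q (lead g))) (wop v))
    (phi3 (wsubst q (lead g)) v - << wop v >> * kop (ksubst q g)).
Proof.
move=> qs Sg.
exact: (composition3_nested (P := P) (m := mon) (@malgU_mul k d Y) mon_op
  (@trivial_mod0 k d Y S) (@trivial_modD k d Y S) (@trivial_modZ k d Y S)
  ksubst_star1 ksubst_lmul (@ksubst_wop k d Y) G3 T_sub G_tail v qs (conj Sg erefl)).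
Qed.

Lemma phi4_nested_trivial q g : is_starword q -> S g ->
  triv (wop (wop (wsubst q (lead g))))
    (phi4 (wsubst q (lead g)) - kop (kop (ksubst q g))).
Proof.
move=> qs Sg.
exact: (composition4_nested (P := P) (m := mon) mon_op
  (@trivial_mod0 k d Y S) (@trivial_modD k d Y S) (@trivial_modZ k d Y S)
  ksubst_star1 (@ksubst_wop k d Y) G4 T_sub G_tail qs (conj Sg erefl)).
Qed.

(** The bounds on the breadth exclude [phi4] and leave two leading words [[x][y]] and [[y][z]]
    sharing one bracket. Since factors are unordered, the shared bracket can occupy any position;
    symmetry of [phi3] brings each case to [fin], and sharing both brackets would force [f = g]. *)
Lemma intersection_compositions f g : S f -> S g -> f <> g ->
  intersection_trivial (@cdb_le d Y) S f g.
Proof.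
move=> Sf Sg fg w mu nu.
case/S_rb_cases: Sf => [[u [v [fE ->]]]|[u [fE ->]]];
case/S_rb_cases: Sg => [[a [b [gE ->]]]|[a [gE ->]]] wE wE';
  have := congr1 (@breadth d Y) wE; have := congr1 (@breadth d Y) wE';
  rewrite !(breadth_mul, breadth_op) => bw' bw lt1 lt2; try lia.
have mu1 : breadth mu = 1%N by lia.
have nu1 : breadth nu = 1%N by lia.
have fin x y z : f = phi3 x y -> g = phi3 y z -> mu = wop z -> nu = wop x ->
    w = wmul (wop x) (wmul (wop y) (wop z)) -> triv w (f * << mu >> - << nu >> * g).
  move=> -> -> -> -> ->; exact: phi3_phi3_trivial.
have one_of x y : breadth (wmul (wop x) y) = 1%N -> y = wone Y.
  by rewrite breadth_mul breadth_op => -[/breadth_eq0].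
rewrite -wmulA in wE; have E := wE; rewrite wE' wmulC -wmulA {bw bw' lt1 lt2} in E.
case/esym/op_factor: E => [[ua]|[r [+ E2]]].
  case/op_factor => [[vb _]|[t [muE nuE]]].
    by exfalso; apply: fg; subst a b; exact: etrans fE (esym gE).
  rewrite muE in mu1; rewrite nuE in nu1; rewrite (one_of _ _ mu1) in muE nuE.
  rewrite wmulm1 in muE; rewrite wmulm1 in nuE.
  subst a; apply: (fin _ _ _ (etrans fE (phi3C u v)) gE muE nuE).
  by rewrite wE muE wmulA [X in wmul X _]wmulC -wmulA.
case/op_factor => [[va muE]|[t [muE rE]]].
  move: E2; rewrite -muE => /op_factor[[bu _]|[t [nuE muE']]].
    by exfalso; apply: fg; subst a b; exact: etrans (etrans fE (phi3C u v)) (esym gE).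
  rewrite muE' in mu1; rewrite nuE in nu1; rewrite (one_of _ _ mu1) in muE' nuE.
  rewrite wmulm1 in muE'; rewrite wmulm1 in nuE.
  by subst a; apply: (fin _ _ _ fE gE muE' nuE); rewrite wE muE'.
rewrite muE in mu1; rewrite (one_of _ _ mu1) in muE rE; rewrite wmulm1 in muE; rewrite wmulm1 in rE.
have wE2 : w = wmul (wop u) (wmul (wop v) (wop a)) by rewrite wE muE.
have wE3 : w = wmul (wop v) (wmul (wop u) (wop a)).
  by rewrite wE2 wmulA [X in wmul X _]wmulC -wmulA.
move: E2; rewrite rE => /op_factor[[bu nuE]|[t' [nuE /op_factor1[vb t'1]]]].
  subst b; exact: (fin _ _ _ (etrans fE (phi3C u v)) (etrans gE (phi3C a u)) muE nuE wE3).
rewrite t'1 wmulm1 in nuE.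
subst b; exact: (fin _ _ _ fE (etrans gE (phi3C a v)) muE nuE wE2).
Qed.

(** The cases follow the place of the star in the leading word of [f]. Outside all brackets, either
    the leading words coincide and [f = g], or some [[[a]]] is a factor of [[u][v]]. Inside a
    bracket, the nested compositions apply, except for the overlap of [phi4] with itself in a triple
    bracket. *)
Lemma including_compositions f g : S f -> S g -> f <> g ->
  including_trivial (@cdb_le d Y) S f g.
Proof.
move=> Sf Sg fg w q qs wf wg; rewrite wf in wg *; move=> {w wf}; have {}Sf := S_rb_cases Sf.
case: (proj2 (starword_cases q) qs) => [[p qE]|[p [r [rs qE]]]]; rewrite {}qE {qs} in wg *.
  rewrite !wsubstE in wg; rewrite ksubst_star; have {}Sg := S_rb_cases Sg.
  case: Sf => [[u [v [fE lf]]]|[u [fE lf]]]; case: Sg => [[a [b [gE lg]]]|[a [gE lg]]];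
    rewrite lf lg in wg *; have := congr1 (@breadth d Y) wg;
    rewrite !(breadth_mul, breadth_op) => bw; try lia.
  - have p1 : p = wone Y by apply: breadth_eq0; lia.
    rewrite p1 wmul1m in wg; exfalso; apply: fg.
    case/op_factor22: wg => -[ua vb]; subst u v; first exact: etrans fE (esym gE).
    exact: etrans (etrans fE (phi3C b a)) (esym gE).
  - have [[ua pE]|[va pE]] : u = wop a /\ p = wop v \/ v = wop a /\ p = wop u.
      by apply: op_factor2; rewrite wg wmulC.
      rewrite fE gE pE ua; exact: phi3_phi4_trivial.
    rewrite fE gE pE va phi3C wmulC; exact: phi3_phi4_trivial.
  have p1 : p = wone Y by apply: breadth_eq0; lia.
  exfalso; apply: fg; rewrite p1 wmul1m in wg; have ua := wop_inj (wop_inj wg).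
  subst u; exact: etrans fE (esym gE).
rewrite !wsubstE in wg; rewrite ksubst_op.
case: Sf => [[u [v [fE lf]]]|[u [fE lf]]]; rewrite {}lf in wg *.
  have [[ur pE]|[vr pE]] : u = wsubst r (lead g) /\ p = wop v \/
      v = wsubst r (lead g) /\ p = wop u.
    by apply: op_factor2; rewrite wg wmulC.
    rewrite fE pE ur; exact: phi3_nested_trivial.
  rewrite fE pE vr phi3C wmulC; exact: phi3_nested_trivial.
have [ur p1] : wop u = wsubst r (lead g) /\ p = wone Y.
  by apply: op_factor1; rewrite wg wmulC.
rewrite p1 -[<< wone Y >>]/(1 : A) mul1r fE {fE wg fg p1 p}.
(* The star lies within [wop u]. At the top of that word only a leading word of [phi4] fits, which
   gives the triple bracket; otherwise the star is inside [u]. *)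
case: (proj2 (starword_cases r) rs) => [[p rE]|[p [z [zs rE]]]]; rewrite {}rE {rs r} in ur *.
  rewrite !wsubstE in ur; rewrite ksubst_star; have {}Sg := S_rb_cases Sg.
  case: Sg => [[a [b [gE lg]]]|[a [gE lg]]]; rewrite {}lg in ur *;
    have := congr1 (@breadth d Y) ur; rewrite !(breadth_mul, breadth_op) => bw; first lia.
  have p1 : p = wone Y by apply: breadth_eq0; lia.
  rewrite p1 wmul1m in ur; rewrite p1 -[<< wone Y >>]/(1 : A) mul1r gE (wop_inj ur).
  exact: phi4_phi4_trivial.
rewrite !wsubstE in ur; rewrite ksubst_op.
have [uE p1] : u = wsubst z (lead g) /\ p = wone Y.
  by apply: op_factor1; rewrite ur wmulC.
rewrite p1 -[<< wone Y >>]/(1 : A) mul1r uE; exact: phi4_nested_trivial.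
Qed.

Lemma S_rb_GS_basis : GS_basis (@cdb_le d Y) S.
Proof.
split=> [f|f g Sf Sg fg]; first exact: S_rb_monic.
by split; [apply: intersection_compositions | apply: including_compositions].
Qed.

End GroebnerShirshovRB.

(** * A recursive description of the irreducible words *)

Section IrreducibleWords.
Variables (d : Order.disp_t) (Y : orderType d).
Implicit Types (u v w p : word Y) (q : word (starred Y)).

Definition is_op (u : raw Y) : bool := if u is Raw [::] [:: _] then true else false.

Fixpoint irr (u : raw Y) : bool :=
  let: Raw _ a := u in
  match a with
  | [::] => true
  | [:: t] => irr t && ~~ is_op t
  | _ => false
  end.

Lemma is_opP u : reflect (exists v, u = wop v) (is_op u).
Proof.
apply: (iffP idP) => [|[v ->] //]; case: u => [[[|y s] [|t [|t' a]]] nu] //= _.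
have nt : normal t by case/and3P: nu => _ _ /andP[].
by exists (Word nt); apply: val_inj.
Qed.

Lemma args_cons w t a : args w = t :: a ->
  exists p v, [/\ w = wmul p (wop v), wval v = t & args p = a].
Proof.
case: w => [[s b] nw] /=; rewrite /args /= => bE; subst b.
have nt : normal t by case/and3P: (nw) => _ _ /andP[].
have np : normal (Raw s a).
  by case/and3P: (nw) => ss /path_sorted sa /andP[_ na]; apply/and3P.
exists (Word np), (Word nt); split=> //; apply: val_inj => /=.
case/and3P: (nw) => ss sa _; rewrite cats0 sorted_sort //; last exact: letter_ge_trans.
congr Raw; rewrite -[LHS](sorted_sort (@raw_ge_trans d Y)) //.
by apply/raw_sortP; rewrite perm_sym perm_catC.
Qed.

Lemma irr_args u v : args u = args v -> irr u = irr v.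
Proof. by case: u v => [[s a] nu] [[t b] nv]; rewrite /args /= => ->. Qed.

Lemma args_mull u v : args u = [::] -> args (wmul u v) = args v.
Proof.
case: u v => [[s a] nu] [[t b] nv]; rewrite /args /= => ->.
by rewrite sorted_sort //; [exact: raw_ge_trans | case/and3P: nv].
Qed.

Lemma irr_nargs u : irr u -> (nargs u <= 1)%N.
Proof. by case: u => [[s [|t [|t' a]]] nu]. Qed.

Lemma irr0 u : args u = [::] -> irr u.
Proof. by case: u => [[s a] nu]; rewrite /args /= => ->. Qed.

Lemma irr_op u : irr (wop u) = irr u && ~~ is_op u.
Proof. by []. Qed.

Lemma irr_mul p u : irr (wmul p u) -> irr u.
Proof.
move=> pu; have := irr_nargs pu; rewrite nargs_mul.
case pE : (args p) => [|t a]; first by rewrite -(irr_args (args_mull u pE)).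
case uE : (args u) => [|t' a']; first by rewrite irr0.
by rewrite /nargs pE uE /= addnS.
Qed.

Lemma irr_wsubst q u : is_starword q -> irr (wsubst q u) -> irr u.
Proof.
move=> qs; elim/starword_ind: q / qs => [p|p q _ IHq]; rewrite !wsubstE => /irr_mul //.
by rewrite irr_op => /andP[/IHq].
Qed.

(** A forbidden pattern in the argument of a bracket is one of the whole word, in the context
    enlarged by that bracket; hence an induction on the degree. *)
Lemma Irr_rbE w : Irr_rb w <-> irr w.
Proof.
split=> [[no_pp no_op]|irr_w]; last first.
  split=> [[q [u [v [qs wE]]]]|[q [u [qs wE]]]]; move: irr_w; rewrite wE => /(irr_wsubst qs).
    by move/irr_nargs; rewrite nargs_mul !nargs_op.
  by rewrite irr_op andbF.
move: {2}(deg w).+1 (ltnSn (deg w)) => n.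
elim: n w no_pp no_op => // n IHn w no_pp no_op degw.
case aE : (args w) => [|t a]; first exact: irr0.
have [p [v [wE vt pE]]] := args_cons aE.
have starM r : is_starword (wmul (lift r) (star Y)) by rewrite starword_mul.
case: a aE pE => [|t' a] aE pE; last first.
  have [p' [v' [pE' _ _]]] := args_cons pE; case: no_pp.
  exists (wmul (lift p') (star Y)), v', v; split=> //.
  by rewrite !wsubstE wE pE' wmulA.
rewrite wE (irr_args (args_mull _ pE)) irr_op; apply/andP; split; last first.
  apply/negP => /is_opP[v' vE]; case: no_op.
  by exists (wmul (lift p) (star Y)), v'; split; rewrite // !wsubstE wE vE.
apply: IHn; last by move: degw; rewrite wE deg_mul deg_op; lia.
- move=> [q [x [y [qs vE]]]]; case: no_pp; exists (wmul (lift p) (wop q)), x, y.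
  by rewrite starword_mul starword_op !wsubstE wE vE.
move=> [q [x [qs vE]]]; case: no_op; exists (wmul (lift p) (wop q)), x.
by rewrite starword_mul starword_op !wsubstE wE vE.
Qed.

End IrreducibleWords.

(** * Irreducible words span the image of all words *)

Section Spanning.
Variables (k : fieldType) (lam : k) (d : Order.disp_t) (Y : orderType d).
Variables (F : comAlgType k) (P : {linear F -> F}) (i : Y -> F).
Hypothesis P_qiRB : qiRB lam P.
Implicit Types (u v w p : word Y) (x y : F).

Definition eval w : F := raw_eval *%R 1 P i w.

Lemma eval_mul u v : eval (wmul u v) = eval u * eval v.
Proof. exact: raw_eval_mul (@mulrA F) (@mulrC F) (@mul1r F) u v. Qed.

Lemma eval_op u : eval (wop u) = P (eval u).
Proof. exact: raw_eval_op (@mulrC F) (@mul1r F) u. Qed.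

(** Repeated words are allowed, so that a sum is a concatenation; like terms are collected only in
    [free_qiRB_spanning]. *)
Definition irr_span x : Prop := exists2 s : seq (k * word Y),
  {in s, forall t, irr (wval t.2)} & x = \sum_(t <- s) t.1 *: eval t.2.

Lemma irr_span_eval w : irr w -> irr_span (eval w).
Proof.
move=> irr_w; exists [:: (1, w)]; last by rewrite big_seq1 scale1r.
by move=> t; rewrite inE => /eqP->.
Qed.

Lemma irr_span0 : irr_span 0.
Proof. by exists [::] => //; rewrite big_nil. Qed.

Lemma irr_spanD x y : irr_span x -> irr_span y -> irr_span (x + y).
Proof.
move=> [s sP ->] [t tP ->]; exists (s ++ t); last by rewrite big_cat.
by move=> c; rewrite mem_cat => /orP[/sP|/tP].
Qed.

Lemma irr_spanZ c x : irr_span x -> irr_span (c *: x).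
Proof.
move=> [s sP ->]; exists [seq (c * t.1, t.2) | t <- s].
  by move=> _ /mapP[t /sP ts ->].
by rewrite big_map scaler_sumr; apply: eq_bigr => t _; rewrite scalerA.
Qed.

Lemma irr_span_linear (f : F -> F) x : linear f ->
  (forall w, irr w -> irr_span (f (eval w))) -> irr_span x -> irr_span (f x).
Proof.
move=> f_lin fP [s sP ->].
pose L := GRing.isLinear.Build k F F *:%R f f_lin.
pose g : {linear F -> F} := HB.pack f L.
rewrite -[f]/(g : F -> F) linear_sum big_seq.
elim/big_rec: _ => [|t z /sP ts zs]; first exact: irr_span0.
by apply: irr_spanD => //; rewrite linearZ; apply/irr_spanZ/fP.
Qed.

Lemma mul_linear x : linear ( *%R x : F -> F).
Proof. by move=> c y z; rewrite mulrDr scalerAr. Qed.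

Lemma irr_span_op x : irr_span x -> irr_span (P x).
Proof.
apply: irr_span_linear => [|w irr_w]; first exact: linearP.
case: (boolP (is_op w)) => [/is_opP[v wE]|no_op].
  by rewrite wE eval_op (proj1 P_qiRB) -eval_op -wE; apply/irr_spanZ/irr_span_eval.
by rewrite -eval_op; apply: irr_span_eval; rewrite irr_op irr_w.
Qed.

Lemma irr_span_mul0 p x : args p = [::] -> irr_span x -> irr_span (eval p * x).
Proof.
move=> p0; apply: (irr_span_linear (mul_linear (eval p))) => w irr_w.
by rewrite -eval_mul; apply: irr_span_eval; rewrite (irr_args (args_mull w p0)).
Qed.

Lemma irr_span_mul_eval u v : irr u -> irr v -> irr_span (eval u * eval v).
Proof.
move: {2}(deg u + deg v).+1 (ltnSn (deg u + deg v)) => n.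
elim: n u v => // n IHn u v degn irr_u irr_v.
case uE : (args u) => [|t a]; first by apply: irr_span_mul0 => //; apply: irr_span_eval.
case vE : (args v) => [|t' a'].
  by rewrite mulrC; apply: irr_span_mul0 => //; apply: irr_span_eval.
have [p [u' [uE' _ pE]]] := args_cons uE; have [r [v' [vE' _ rE]]] := args_cons vE.
have p0 : args p = [::].
  by apply: size0nil; move: (irr_nargs irr_u); rewrite /nargs uE -pE /=; case: size.
have r0 : args r = [::].
  by apply: size0nil; move: (irr_nargs irr_v); rewrite /nargs vE -rE /=; case: size.
have irr_u' := irr_u; rewrite uE' in irr_u'; have {}irr_u' := irr_mul irr_u'.
have irr_v' := irr_v; rewrite vE' in irr_v'; have {}irr_v' := irr_mul irr_v'.
have [iu' iv'] : irr u' /\ irr v'.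
  by move: irr_u' irr_v'; rewrite !irr_op => /andP[-> _] /andP[-> _].
move: degn; rewrite uE' vE' !deg_mul !deg_op !eval_mul !eval_op mulrACA => degn.
(* By irreducibility [p] and [r] consist of letters only, so they can be multiplied back at the end
   without creating a forbidden pattern. *)
rewrite (proj2 P_qiRB) -mulrA.
do 2![apply: irr_span_mul0 => //]; do ![apply: irr_spanD | apply: irr_spanZ];
  apply: irr_span_op; rewrite -?eval_op; apply: IHn => //; rewrite ?deg_op; lia.
Qed.

Lemma irr_span_mul x y : irr_span x -> irr_span y -> irr_span (x * y).
Proof.
move=> xs ys; move: xs; rewrite mulrC.
apply: (irr_span_linear (mul_linear y)) => u irr_u; rewrite mulrC.
move: ys; apply: (irr_span_linear (mul_linear (eval u))) => v irr_v.
exact: irr_span_mul_eval.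
Qed.

Lemma irr_span_word w : irr_span (eval w).
Proof.
elim/word_ind: w => [|y u IHu|u v IHu IHv]; first exact: irr_span_eval.
  by rewrite eval_mul; apply: irr_span_mul0.
by rewrite eval_mul eval_op; apply: irr_span_mul => //; apply: irr_span_op.
Qed.

End Spanning.

(** * The canonical homomorphism is a morphism of operated algebras *)

Section CanonicalHom.
Variables (k : fieldType) (d : Order.disp_t) (Y : orderType d).
Local Notation A := {malg k[word Y]}.

Lemma malg_linear_ext (V : lmodType k) (f g : A -> V) : linear f -> linear g ->
  (forall w : word Y, f << w >> = g << w >>) -> f =1 g.
Proof.
move=> f_lin g_lin fg x.
pose Lf := GRing.isLinear.Build k A V *:%R f f_lin.
pose Lg := GRing.isLinear.Build k A V *:%R g g_lin.
pose f' : {linear A -> V} := HB.pack f Lf; pose g' : {linear A -> V} := HB.pack g Lg.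
rewrite -[LHS]/(f' x) -[RHS]/(g' x) [x]malg_expand !linear_sum.
by apply: eq_bigr => w _; rewrite !linearZ; congr (_ *: _); apply: fg.
Qed.

Variables (F : comAlgType k) (P : {linear F -> F}) (i : Y -> F).
Local Notation can := (canonical_hom P i).

Lemma canonical_homEw (D : {fset word Y}) (f : A) : (msupp f `<=` D)%fset ->
  can f = \sum_(w <- D) f@_w *: eval P i w.
Proof.
move=> fD; rewrite /canonical_hom (big_fset_incl _ fD) // => w _ /mcoeff_outdom ->.
by rewrite scale0r.
Qed.

Lemma canonical_hom_linear : linear can.
Proof.
move=> c f g; pose D := (msupp f `|` msupp g)%fset.
have fD : (msupp f `<=` D)%fset by apply: fsubsetUl.
have gD : (msupp g `<=` D)%fset by apply: fsubsetUr.
have cD : (msupp (c *: f + g) `<=` D)%fset.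
  apply: fsubset_trans (msuppD_le _ _) _; rewrite fsubUset gD andbT.
  exact: fsubset_trans (msuppZ_le _ _) fD.
rewrite (canonical_homEw fD) (canonical_homEw gD) (canonical_homEw cD).
rewrite scaler_sumr -big_split /=; apply: eq_bigr => w _.
by rewrite mcoeffD mcoeffZ scalerDl scalerA.
Qed.
HB.instance Definition _ := GRing.isLinear.Build k A F *:%R can canonical_hom_linear.

Lemma canonical_hom_monoid : monoid_morphism can.
Proof.
split=> [|f g]; first exact: canonical_homU.
move: f; apply: malg_linear_ext => [c x y|c x y|u].
- by rewrite mulrDl -scalerAl canonical_hom_linear.
- by rewrite canonical_hom_linear mulrDl -scalerAl.
move: g; apply: malg_linear_ext => [c x y|c x y|v].
- by rewrite mulrDr -scalerAr canonical_hom_linear.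
- by rewrite canonical_hom_linear mulrDr -scalerAr.
apply: etrans (congr1 can (esym (malgU_mul k u v))) _.
apply: etrans (etrans (canonical_homU P i _) (eval_mul P i u v)) _.
exact: esym (congr2 *%R (canonical_homU P i u) (canonical_homU P i v)).
Qed.
HB.instance Definition _ :=
  GRing.isMonoidMorphism.Build A F can canonical_hom_monoid.

Lemma canonical_homD f g : can (f + g) = can f + can g.
Proof. exact: raddfD. Qed.

Lemma canonical_homM f g : can (f * g) = can f * can g.
Proof. exact: rmorphM. Qed.

Lemma canonical_hom_op f : can (kop f) = P (can f).
Proof.
move: f; apply: malg_linear_ext => [c x y|c x y|w].
- by rewrite kop_is_linear canonical_hom_linear.
- by rewrite canonical_hom_linear linearP.
rewrite (canonical_homU P i w); apply: etrans (congr1 can (kopU 1 w)) _.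
exact: etrans (canonical_homU P i _) (eval_op P i w).
Qed.

End CanonicalHom.

(** * The quotient of a commutative algebra by an ideal *)

Section IdealQuotient.
Variables (k : fieldType) (A : comAlgType k) (I : idealr A).
Implicit Types (a b : k) (x y : A).
Local Notation I_pred := (I : pred A).

Definition ideal_algebra := {ideal_quot I}.
HB.instance Definition _ := GRing.ComNzRing.on ideal_algebra.
Implicit Types p q : ideal_algebra.

Definition quotient_map x : ideal_algebra := \pi_({ideal_quot I})%qT x.

Lemma quotient_mapB : zmod_morphism quotient_map.
Proof. exact: raddfB. Qed.

Lemma quotient_mapM : monoid_morphism quotient_map.
Proof. by split; [apply: rmorph1 | apply: rmorphM]. Qed.

HB.instance Definition _ :=
  GRing.isZmodMorphism.Build A ideal_algebra quotient_map quotient_mapB.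
HB.instance Definition _ :=
  GRing.isMonoidMorphism.Build A ideal_algebra quotient_map quotient_mapM.

Lemma quotient_map_eq x y : quotient_map x = quotient_map y <-> x - y \in I_pred.
Proof. by rewrite Quotient.idealrBE; split=> [/eqP|/eqP]. Qed.

Lemma quotient_map_surj p : exists x, p = quotient_map x.
Proof. by exists (repr p); rewrite /quotient_map reprK. Qed.

(** Scalars act through their image in the quotient ring, so that the module axioms become ring
    identities. *)
Definition quotient_scale a p : ideal_algebra := quotient_map a%:A * p.

Fact quotient_scaleA a b p :
  quotient_scale a (quotient_scale b p) = quotient_scale (a * b) p.
Proof. by rewrite /quotient_scale mulrA -rmorphM -scalerAl mul1r scalerA. Qed.
Fact quotient_scale1 : left_id 1 quotient_scale.
Proof. by move=> p; rewrite /quotient_scale scale1r rmorph1 mul1r. Qed.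
Fact quotient_scaleDr : right_distributive quotient_scale +%R.
Proof. by move=> a p q; rewrite /quotient_scale mulrDr. Qed.
Fact quotient_scaleDl p : {morph quotient_scale^~ p : a b / a + b}.
Proof. by move=> a b; rewrite /quotient_scale scalerDl rmorphD mulrDl. Qed.
HB.instance Definition _ := GRing.Zmodule_isLmodule.Build k ideal_algebra
  quotient_scaleA quotient_scale1 quotient_scaleDr quotient_scaleDl.

Fact quotient_scaleAl a p q : a *: (p * q) = a *: p * q.
Proof. exact: mulrA. Qed.
HB.instance Definition _ :=
  GRing.Lmodule_isLalgebra.Build k ideal_algebra quotient_scaleAl.
HB.instance Definition _ := GRing.Lalgebra_isComAlgebra.Build k ideal_algebra.

Fact quotient_map_scalable : scalable quotient_map.
Proof.
by move=> a x; rewrite -[in LHS](mul1r x) scalerAl rmorphM.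
Qed.
HB.instance Definition _ :=
  GRing.isScalable.Build k A ideal_algebra *:%R quotient_map quotient_map_scalable.

Section Lift.
Variables (V : lmodType k) (f : {linear A -> V}).
Hypothesis fI : forall x, x \in I_pred -> f x = 0.

Definition quotient_lift p : V := f (repr p).

Lemma quotient_liftE x : quotient_lift (quotient_map x) = f x.
Proof.
apply/eqP; rewrite -subr_eq0 -linearB; apply/eqP/fI/quotient_map_eq.
by rewrite /quotient_map reprK.
Qed.

Lemma quotient_lift_linear : linear quotient_lift.
Proof.
move=> a p q; have [x ->] := quotient_map_surj p; have [y ->] := quotient_map_surj q.
by rewrite -linearP !quotient_liftE linearP.
Qed.
End Lift.

Lemma quotient_linear (V : lmodType k) (f : {linear A -> V}) :
  (forall x, x \in I_pred -> f x = 0) ->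
  exists h : {linear ideal_algebra -> V}, forall x, h (quotient_map x) = f x.
Proof.
move=> fI; pose L := GRing.isLinear.Build k ideal_algebra V *:%R (quotient_lift f)
  (quotient_lift_linear fI).
pose g : {linear ideal_algebra -> V} := HB.pack (quotient_lift f) L.
by exists g; apply: quotient_liftE.
Qed.

Lemma quotient_lrmorphism (B : comAlgType k) (f : {lrmorphism A -> B}) :
  (forall x, x \in I_pred -> f x = 0) ->
  exists h : {lrmorphism ideal_algebra -> B}, forall x, h (quotient_map x) = f x.
Proof.
move=> fI; have hE := quotient_liftE fI.
have h_mul : monoid_morphism (quotient_lift f).
  split=> [|p q]; first by rewrite -(rmorph1 quotient_map) hE rmorph1.
  have [x ->] := quotient_map_surj p; have [y ->] := quotient_map_surj q.
  by rewrite -rmorphM !hE rmorphM.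
pose L := GRing.isLinear.Build k ideal_algebra B *:%R (quotient_lift f)
  (quotient_lift_linear fI).
pose M := GRing.isMonoidMorphism.Build ideal_algebra B (quotient_lift f) h_mul.
pose g : {lrmorphism ideal_algebra -> B} := HB.pack (quotient_lift f) L M.
by exists g.
Qed.

End IdealQuotient.

(** * Construction of the free object, and spanning in any free object *)

Section RelationsUnderHom.
Variables (k : fieldType) (lam : k) (A R : comAlgType k).
Variables (K : {linear A -> A}) (P : {linear R -> R}) (h : {lrmorphism A -> R}).
Hypotheses (P_qiRB : qiRB lam P) (hK : forall x, h (K x) = P (h x)).

Lemma qi_relation_hom x : h (K (K x) - (- lam *: K x)) = 0.
Proof. by rewrite linearB linearZ /= !hK (proj1 P_qiRB) subrr. Qed.

Lemma rb_relation_hom x y :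
  h (K x * K y - (K (x * K y) + K (K x * y) + lam *: K (x * y))) = 0.
Proof.
rewrite linearB !linearD linearZ /= rmorphM /= !hK !rmorphM /= !hK (proj2 P_qiRB).
by rewrite -!opprD subrr.
Qed.
End RelationsUnderHom.

Lemma qiRB_surjective (k : fieldType) (lam : k) (A R : comAlgType k)
    (K : {linear A -> A}) (P : {linear R -> R}) (h : {lrmorphism A -> R}) :
  (forall y, exists x, y = h x) -> (forall x, P (h x) = h (K x)) ->
  (forall x, h (K (K x)) = h (- lam *: K x)) ->
  (forall x y, h (K x * K y) = h (K (x * K y) + K (K x * y) + lam *: K (x * y))) ->
  qiRB lam P.
Proof.
move=> h_surj PE qi rb; split=> [z|z t]; have [x ->] := h_surj z.
  by rewrite !PE qi linearZ.
have [y ->] := h_surj t; move: (rb x y).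
by rewrite linearD linearD linearZ /= !rmorphM /= -!PE !rmorphM /= -!PE.
Qed.

Section FreeObject.
Variables (k : fieldType) (lam : k) (d : Order.disp_t) (Y : orderType d).
Local Notation A := {malg k[word Y]}.

Lemma extends_hom_eval (R R' : comAlgType k) (P : {linear R -> R})
    (P' : {linear R' -> R'}) (i : Y -> R) (j : Y -> R') (h : {lrmorphism R -> R'}) w :
  extends_hom P P' i j h -> h (eval P i w) = eval P' j w.
Proof.
case=> hi hP; apply: raw_eval_morph => //; [exact: rmorph1 | exact: rmorphM].
Qed.

(** The common kernel of all canonical homomorphisms, rather than the ideal generated by the
    relations: maps to any target factor through the quotient at once, and stability under [kop] and
    the relations are checked in each target. *)
Definition qiRB_ideal : pred A := fun f => `[< forall (R : comAlgType k)
  (P : {linear R -> R}) (i : Y -> R), qiRB lam P -> canonical_hom P i f = 0 >].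

Lemma qiRB_idealP f : reflect (forall (R : comAlgType k)
  (P : {linear R -> R}) (i : Y -> R), qiRB lam P -> canonical_hom P i f = 0)
  (f \in qiRB_ideal).
Proof. exact: asboolP. Qed.

Fact qiRB_ideal_closed : idealr_closed qiRB_ideal.
Proof.
split=> [||a u v /qiRB_idealP uI /qiRB_idealP vI].
- by apply/qiRB_idealP => R P i _; exact: (raddf0 (canonical_hom P i)).
(* The ideal is proper: in [k] with the zero operator, and all letters sent to zero, the unit
   survives. *)
- apply/qiRB_idealP => /(_ (k^o : comAlgType k) \0 (fun=> 0)) can0.
  have /can0/eqP : qiRB lam (\0 : {linear k^o -> k^o}).
    by split=> [x|x y]; rewrite /= ?scaler0 ?mulr0 ?addr0.
  apply/negP; have -> : canonical_hom (\0 : {linear k^o -> k^o}) (fun=> 0) (1 : A) = 1.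
    exact: (rmorph1 (canonical_hom (\0 : {linear k^o -> k^o}) (fun=> 0))).
  exact: oner_neq0.
apply/qiRB_idealP => R P i qP.
apply: etrans (canonical_homD P i (a * u) v) _.
by rewrite canonical_homM uI // vI // mulr0 addr0.
Qed.
HB.instance Definition _ := isIdealr.Build A qiRB_ideal qiRB_ideal_closed.

Lemma qiRB_ideal_kop f : f \in qiRB_ideal -> kop f \in qiRB_ideal.
Proof.
move=> /qiRB_idealP fI; apply/qiRB_idealP => R P i qP.
by rewrite canonical_hom_op fI // linear0.
Qed.

Lemma extends_hom_canonical (R R' : comAlgType k) (P : {linear R -> R})
    (P' : {linear R' -> R'}) (i : Y -> R) (j : Y -> R') (h : {lrmorphism R -> R'})
    (f : A) :
  extends_hom P P' i j h -> h (canonical_hom P i f) = canonical_hom P' j f.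
Proof.
move=> hP; rewrite /canonical_hom linear_sum; apply: eq_bigr => w _.
by rewrite linearZ; congr (_ *: _); apply: extends_hom_eval hP.
Qed.

Lemma qiRB_ideal_qi (f : A) : kop (kop f) - (- lam *: kop f) \in qiRB_ideal.
Proof.
apply/qiRB_idealP => R P i qP.
exact: (qi_relation_hom (K := @kop k d Y) (h := canonical_hom P i) qP
  (canonical_hom_op P i) f).
Qed.

Lemma qiRB_ideal_rb (f g : A) : kop f * kop g
  - (kop (f * kop g) + kop (kop f * g) + lam *: kop (f * g)) \in qiRB_ideal.
Proof.
apply/qiRB_idealP => R P i qP.
exact: (rb_relation_hom (K := @kop k d Y) (h := canonical_hom P i) qP
  (canonical_hom_op P i) f g).
Qed.

Let I : idealr A := qiRB_ideal.
Let Q : comAlgType k := ideal_algebra I.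
Let proj : {lrmorphism A -> Q} := @quotient_map k A I.

Let proj_eq (f g : A) : f - g \in qiRB_ideal -> proj f = proj g.
Proof. by move=> fg; apply/(quotient_map_eq I f g). Qed.

Let proj_surj (x : Q) : exists f, x = proj f.
Proof. exact: quotient_map_surj. Qed.

Lemma free_qiRB_exists : exists (F : comAlgType k) (P : {linear F -> F}) (i : Y -> F),
  free_qiRB lam P i /\ forall x, exists f : A, x = canonical_hom P i f.
Proof.
have proj0 f : f \in qiRB_ideal -> proj (kop f) = 0.
  move=> /qiRB_ideal_kop fI; rewrite -(raddf0 proj); apply: proj_eq.
  by rewrite subr0.
pose pk : {linear A -> Q} := proj \o @kop k d Y.
have [P PE] := quotient_linear (f := pk) proj0.
have {}PE f : P (proj f) = proj (kop f) by apply: PE.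
pose i y := proj << wletter y >>.
have projM u v : proj << wmul u v >> = proj << u >> * proj << v >>.
  exact: etrans (congr1 proj (malgU_mul k u v)) (rmorphM proj _ _).
have evalE w : eval P i w = proj << w >>.
  elim/word_ind: w => [|y u IHu|u v IHu IHv].
  - exact: esym (rmorph1 proj).
  - have letE : eval P i (wletter y) = proj << wletter y >>.
      exact: raw_eval_letter (@mulrC Q) (@mul1r Q) y.
    rewrite eval_mul IHu letE; exact: esym (projM _ _).
  have opE : P (proj << u >>) = proj << wop u >>.
    exact: etrans (PE << u >>) (congr1 proj (kopU 1 u)).
  rewrite eval_mul eval_op IHu IHv opE; exact: esym (projM _ _).
have canE f : canonical_hom P i f = proj f.
  move: f; apply: malg_linear_ext => [||w]; [exact: linearP.. |].
  exact: etrans (canonical_homU P i w) (evalE w).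
exists Q, P, i; split; last first.
  by move=> x; have [f ->] := proj_surj x; exists f; rewrite canE.
split.
  apply: (qiRB_surjective (K := @kop k d Y) proj_surj PE) => [f|f g]; apply: proj_eq.
    exact: qiRB_ideal_qi.
  exact: qiRB_ideal_rb.
move=> R PR j qPR.
have [h hE] := quotient_lrmorphism (f := canonical_hom PR j)
  (fun f fI => elimT (qiRB_idealP f) fI R PR j qPR).
have {}hE f : h (proj f) = canonical_hom PR j f by apply: hE.
exists h; split=> [|h' h'P x]; last first.
  have [f ->] := proj_surj x; rewrite hE -canE.
  exact: extends_hom_canonical h'P.
split=> [y|x].
  rewrite /i hE canonical_homU.
  exact: raw_eval_letter (@mulrC R) (@mul1r R) y.
by have [f ->] := proj_surj x; rewrite PE !hE canonical_hom_op.
Qed.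

(** The constructed object [F'] is generated by words. Uniqueness makes the composite [F -> F' -> F]
    the identity, so the second map is onto and carries this property to an arbitrary free
    object. *)
Lemma free_qiRB_generated (F : comAlgType k) (P : {linear F -> F}) (i : Y -> F) :
  free_qiRB lam P i -> forall x, exists f : A, x = canonical_hom P i f.
Proof.
move=> [qP univ] x.
have [F' [P' [i' [[qP' univ'] gen]]]] := free_qiRB_exists.
have [g [gP _]] := univ F' P' i' qP'; have [h [hP _]] := univ' F P i qP.
have [f gx] := gen (g x); exists f.
have [e [_ e_uniq]] := univ F P i qP.
pose hg : {lrmorphism F -> F} := h \o g.
pose idF : {lrmorphism F -> F} := idfun.
have hg_ext : extends_hom P P i i hg.
  by split=> [y|z] /=; [rewrite (proj1 gP) (proj1 hP) | rewrite (proj2 gP) (proj2 hP)].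
have id_ext : extends_hom P P i i idF by [].
rewrite -(extends_hom_canonical f hP) -gx.
by rewrite -[LHS]/(idF x) (e_uniq _ id_ext) -(e_uniq _ hg_ext).
Qed.

Lemma free_qiRB_spanned (F : comAlgType k) (P : {linear F -> F}) (i : Y -> F) :
  free_qiRB lam P i -> forall x, irr_span P i x.
Proof.
move=> freeF x; have [f ->] := free_qiRB_generated freeF x.
rewrite /canonical_hom; elim/big_rec: _ => [|w y _ ys]; first exact: irr_span0.
by apply: irr_spanD => //; apply: irr_spanZ; apply: irr_span_word (proj1 freeF) w.
Qed.

Lemma free_qiRB_spanning (F : comAlgType k) (P : {linear F -> F}) (i : Y -> F) :
  free_qiRB lam P i -> forall x, exists (s : seq (word Y)) (c : word Y -> k),
    (forall w, w \in s -> Irr_rb w) /\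
    x = \sum_(w <- s) c w *: canonical_hom P i << w >>.
Proof.
move=> freeF x; have [s sP ->] := free_qiRB_spanned freeF x.
exists (undup (map snd s)), (fun w => \sum_(t <- s | t.2 == w) t.1); split.
  by move=> w; rewrite mem_undup => /mapP[t /sP ts ->]; apply/Irr_rbE.
transitivity (\sum_(w <- undup (map snd s)) \sum_(t <- s | t.2 == w) t.1 *: eval P i w).
  rewrite (exchange_big_dep xpredT) //= !big_seq; apply: eq_bigr => t ts.
  have t2 : t.2 \in undup (map snd s) by rewrite mem_undup map_f.
  under eq_bigl => w do rewrite eq_sym.
  by rewrite -big_filter filter_pred1_uniq ?undup_uniq // big_seq1.
apply: eq_bigr => w _; rewrite -scaler_suml; congr (_ *: _).
exact: esym (canonical_homU P i w).
Qed.

End FreeObject.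

(* Signals are functions of a time [n], a side (left [false] or right [true] of
   the instant [n]) and a boolean [c]. *)
Definition signal (K : Type) : Type := nat * bool * bool -> K.

(** * The quasi-idempotent Rota-Baxter algebra of signals *)

Section SignalAlgebra.
Variables (k : fieldType) (K : comAlgType k).
Local Notation sig := (signal K).
Implicit Types f g h : sig.

HB.instance Definition _ := gen_eqMixin sig.
HB.instance Definition _ := gen_choiceMixin sig.

Let eqS f g : (forall t, f t = g t) -> f = g. Proof. by move=> fg; apply/funext. Qed.

Definition sig0 : sig := fun=> 0.
Definition sig_opp f : sig := fun t => - f t.
Definition sig_add f g : sig := fun t => f t + g t.
Definition sig1 : sig := fun=> 1.
Definition sig_mul f g : sig := fun t => f t * g t.
Definition sig_scale (a : k) f : sig := fun t => a *: f t.

Fact sig_addA : associative sig_add.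
Proof. by move=> f g h; apply: eqS => t; apply: addrA. Qed.
Fact sig_addC : commutative sig_add.
Proof. by move=> f g; apply: eqS => t; apply: addrC. Qed.
Fact sig_add0 : left_id sig0 sig_add.
Proof. by move=> f; apply: eqS => t; apply: add0r. Qed.
Fact sig_addN : left_inverse sig0 sig_opp sig_add.
Proof. by move=> f; apply: eqS => t; apply: addNr. Qed.
HB.instance Definition _ := GRing.isZmodule.Build sig sig_addA sig_addC sig_add0 sig_addN.

Fact sig_mulA : associative sig_mul.
Proof. by move=> f g h; apply: eqS => t; apply: mulrA. Qed.
Fact sig_mulC : commutative sig_mul.
Proof. by move=> f g; apply: eqS => t; apply: mulrC. Qed.
Fact sig_mul1 : left_id sig1 sig_mul.
Proof. by move=> f; apply: eqS => t; apply: mul1r. Qed.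
Fact sig_mulDl : left_distributive sig_mul sig_add.
Proof. by move=> f g h; apply: eqS => t; apply: mulrDl. Qed.
Fact sig1_neq0 : sig1 != sig0.
Proof.
by apply/eqP => /(congr1 (fun f => f (0%N, true, true)))/eqP; rewrite /sig1 /sig0 oner_eq0.
Qed.
HB.instance Definition _ := GRing.Zmodule_isComNzRing.Build sig
  sig_mulA sig_mulC sig_mul1 sig_mulDl sig1_neq0.

Fact sig_scaleA a b f : sig_scale a (sig_scale b f) = sig_scale (a * b) f.
Proof. by apply: eqS => t; apply: scalerA. Qed.
Fact sig_scale1 : left_id 1 sig_scale.
Proof. by move=> f; apply: eqS => t; apply: scale1r. Qed.
Fact sig_scaleDr : right_distributive sig_scale +%R.
Proof. by move=> a f g; apply: eqS => t; apply: scalerDr. Qed.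
Fact sig_scaleDl f : {morph sig_scale^~ f : a b / a + b}.
Proof. by move=> a b; apply: eqS => t; apply: scalerDl. Qed.
HB.instance Definition _ := GRing.Zmodule_isLmodule.Build k sig
  sig_scaleA sig_scale1 sig_scaleDr sig_scaleDl.

Fact sig_scaleAl (a : k) f g : a *: (f * g) = a *: f * g.
Proof. by apply: eqS => t; apply: scalerAl. Qed.
HB.instance Definition _ := GRing.Lmodule_isLalgebra.Build k sig sig_scaleAl.
HB.instance Definition _ := GRing.Lalgebra_isComAlgebra.Build k sig.

Lemma sigDE f g t : (f + g) t = f t + g t. Proof. by []. Qed.
Lemma sigME f g t : (f * g) t = f t * g t. Proof. by []. Qed.
Lemma sigZE a f t : (a *: f) t = a *: f t. Proof. by []. Qed.
Lemma sig_sumE (I : Type) (r : seq I) (F : I -> sig) t :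
  (\sum_(i <- r) F i) t = \sum_(i <- r) F i t.
Proof. by elim/big_rec2: _ => // i x y _ <-. Qed.

(* The projection onto the signals that are continuous at every instant (and
   vanish at [0] when [c] is false), along those that are constant between two
   instants (and vanish at [0] when [c] is true): these are subalgebras, so that
   [- lam] times the projection is a Rota-Baxter operator. *)
Definition cont f (n : nat) (c : bool) : K :=
  (if c then f (0%N, false, c) else 0) +
  \sum_(0 <= j < n) (f (j.+1, false, c) - f (j, true, c)).

Lemma contS f n c :
  cont f n.+1 c = cont f n c + (f (n.+1, false, c) - f (n, true, c)).
Proof. by rewrite /cont big_nat_recr //= addrA. Qed.

Lemma cont0 f c : cont f 0 c = if c then f (0%N, false, c) else 0.
Proof. by rewrite /cont big_geq ?addr0. Qed.

Definition cont_sig f : sig := fun t => cont f t.1.1 t.2.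

Lemma cont_idem f n c : cont (cont_sig f) n c = cont f n c.
Proof.
elim: n => [|n IHn]; first by rewrite !cont0 /cont_sig /= cont0; case: c.
by rewrite contS IHn /cont_sig /= addrC addrNK.
Qed.

(** The projection has weight [-1]. From [n] to [n.+1] this is the formula for the increment of a
    product, the inner [cont_sig] being read at [n.+1] for the left-hand value and at [n] for the
    right-hand one. *)
Lemma cont_rb f g n c : cont f n c * cont g n c =
  cont (f * cont_sig g) n c + cont (cont_sig f * g) n c - cont (f * g) n c.
Proof.
elim: n => [|n IHn].
  rewrite !cont0; case: c => //; last by rewrite mulr0 oppr0 !addr0.
  by rewrite !sigME /cont_sig /= !cont0 addrK.
rewrite [cont (f * cont_sig g) _ _]contS [cont (cont_sig f * g) _ _]contS.
rewrite [cont (f * g) _ _]contS !sigME /cont_sig /= -/(cont_sig f) -/(cont_sig g).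
have -> : cont (f * cont_sig g) n c =
    cont f n c * cont g n c - cont (cont_sig f * g) n c + cont (f * g) n c.
  by rewrite IHn; ring.
by rewrite !contS; ring.
Qed.

Lemma contD n c f g : cont (f + g) n c = cont f n c + cont g n c.
Proof.
elim: n => [|n IHn]; first by rewrite !cont0; case: c; rewrite ?addr0.
by rewrite !contS IHn !sigDE; ring.
Qed.

Lemma contZ n c (a : k) f : cont (a *: f) n c = a *: cont f n c.
Proof.
elim: n => [|n IHn]; first by rewrite !cont0; case: c; rewrite ?scaler0.
by rewrite !contS IHn !sigZE -scalerBr -scalerDr.
Qed.

Variable lam : k.

Definition sig_op f : sig := - lam *: cont_sig f.

Fact sig_op_linear : linear sig_op.
Proof.
move=> a f g; apply: eqS => t; rewrite /sig_op !(sigDE, sigZE) /cont_sig contD contZ.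
by rewrite scalerDr !scalerA [a * _]mulrC.
Qed.
HB.instance Definition _ :=
  GRing.isLinear.Build k sig sig *:%R sig_op sig_op_linear.

(** The factor [- lam] turns weight [-1] into weight [lam], and idempotency into [P^2 = - lam P]. *)
Lemma sig_op_qiRB : qiRB lam (sig_op : {linear sig -> sig}).
Proof.
have opE (h : sig) t : sig_op h t = - lam *: cont h t.1.1 t.2 by [].
split=> [f|f g] /=; apply: eqS => t.
  by rewrite sigZE !opE [in LHS]/sig_op contZ cont_idem.
have -> : f * sig_op g = - lam *: (f * cont_sig g) by rewrite scalerAr.
have -> : sig_op f * g = - lam *: (cont_sig f * g) by rewrite scalerAl.
rewrite !(sigDE, sigME, sigZE) !opE !contZ -scalerAl -scalerAr cont_rb.
have [l lE] : exists l : K, forall x, lam *: x = l * x.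
  by exists lam%:A => x; rewrite mulr_algl.
by rewrite !scaleNr !lE; ring.
Qed.

End SignalAlgebra.

(** * Monomials in timed letters, and how they determine a chain *)

Section TimedMonomials.
Variables (d : Order.disp_t) (Y : orderType d).
Local Notation mono := {cmonom (Y * nat)%type}.
Implicit Types (s t : seq Y) (l r : seq (seq Y)) (a b : mono).

Definition timed s (n : nat) : mono :=
  foldr (fun y a => mmul (ucm (y, n)) a) (mone : mono) s.

Lemma timedE s n y j : timed s n (y, j) = if j == n then count_mem y s else 0%N.
Proof.
elim: s => [|z s IHs] /=; first by rewrite cm1 if_same.
by rewrite cmM cmU IHs xpair_eqE [n == j]eq_sym; case: (j == n); rewrite ?andbT ?andbF.
Qed.

(* The monomials [timed s1 i1 * timed s2 i2 * ...] with [n > i1 > i2 > ...] *)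
Fixpoint chains l : nat -> seq mono :=
  if l is s :: l' then
    fix chains_below n :=
      if n is i.+1 then chains_below i ++ map (mmul (timed s i)) (chains l' i) else [::]
  else fun=> [:: mone].

Lemma chainsS s l n :
  chains (s :: l) n.+1 = chains (s :: l) n ++ map (mmul (timed s n)) (chains l n).
Proof. by []. Qed.

Lemma chains_below l n a y j : a \in chains l n -> (n <= j)%N -> a (y, j) = 0%N.
Proof.
elim: l n a => [|s l IHl] n a; first by rewrite inE => /eqP-> _; apply: cm1.
elim: n a => // n IHn a; rewrite chainsS mem_cat => /orP[/IHn IH|/mapP[b bl ->]] nj.
  by apply: IH; apply: ltnW.
by rewrite cmM timedE gtn_eqF // (IHl _ _ bl) // ltnW.
Qed.

(** Below the instant [size r] there is a single decreasing choice of [size r] instants; this is its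
    monomial. *)
Fixpoint top_chain r : mono :=
  if r is s :: r' then mmul (timed s (size r')) (top_chain r') else mone.

Lemma top_chain_below r y j : (size r <= j)%N -> top_chain r (y, j) = 0%N.
Proof.
elim: r => [|s r IHr] /= sj; first exact: cm1.
by rewrite cmM timedE gtn_eqF // IHr // ltnW.
Qed.

Local Notation nonempty_all := (all (fun s : seq Y => s != [::])).
Local Notation sorted_all := (all (sorted (@letter_ge d Y))).

Lemma timed_mul_eq s t n a b : sorted (@letter_ge d Y) s -> sorted (@letter_ge d Y) t ->
  (forall y, a (y, n) = 0%N) -> (forall y, b (y, n) = 0%N) ->
  (mmul (timed s n) a == mmul (timed t n) b) = (s == t) && (a == b).
Proof.
move=> ss st an bn; apply/eqP/idP => [E|/andP[/eqP-> /eqP->] //].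
have st_eq : s = t.
  apply: (sorted_eq (@letter_ge_trans d Y) (@letter_ge_anti d Y)) => //.
  apply/allP => y _ /=; have := congr1 (fun c : mono => c (y, n)) E.
  by rewrite /= !cmM !timedE eqxx an bn !addn0 => ->.
apply/andP; split; first exact/eqP.
apply/cmP => i; have := congr1 (fun c : mono => c i) E.
by rewrite /= !cmM st_eq => /addnI.
Qed.

(** [top_chain r] occupies every instant below [size r]. A chain equal to it must therefore start at
    the last of them, where the letters with that time give back its first entry; induction recovers
    the rest. Nonempty entries make each instant visible, and sorted ones are determined by their
    multisets. *)
Lemma count_chains l r : nonempty_all l -> nonempty_all r ->
  sorted_all l -> sorted_all r -> count_mem (top_chain r) (chains l (size r)) = (l == r).
Proof.
elim: r l => [|t r IHr] [|s l] //.
- by move=> *; rewrite /= eqxx.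
- move=> _ /= /andP[t0 _] _ _; rewrite addn0; case: eqP => // E.
  case: t t0 E => // y t _ /(congr1 (fun c : mono => c (y, size r))).
  by rewrite cm1 cmM timedE eqxx /= eqxx.
move=> /andP[s0 l0] /andP[t0 r0] /andP[ss sl] /andP[st sr].
rewrite [size _]/= chainsS count_cat.
have /count_memPn -> : top_chain (t :: r) \notin chains (s :: l) (size r).
  apply/negP => tr; have E y := chains_below y tr (leqnn _).
  by case: t t0 {st tr} E => // y t _ /(_ y); rewrite cmM timedE eqxx /= eqxx.
rewrite add0n count_map eqseq_cons.
have -> : ((s == t) && (l == r) : nat) = ((s == t) * (l == r))%N.
  by case: (s == t); rewrite ?mul1n.
rewrite -(IHr l) //; case: (s =P t) => [st_eq|/eqP st_neq].
  rewrite mul1n; apply: eq_in_count => a al /=; rewrite timed_mul_eq // ?st_eq ?eqxx //.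
    by move=> y; apply: chains_below al _.
  by move=> y; apply: top_chain_below.
rewrite mul0n -(count_pred0 (chains l (size r))); apply: eq_in_count => a al /=.
rewrite timed_mul_eq ?(negbTE st_neq) // => y; first exact: chains_below al _.
exact: top_chain_below.
Qed.

End TimedMonomials.

(** * Irreducible words as lists of letter blocks *)

Section WordShape.
Variables (d : Order.disp_t) (Y : orderType d).
Implicit Types (u v : raw Y).

Definition raw_one : raw Y := Raw [::] [::].

(* An irreducible word is [s0 [s1 [ ... [sn] ... ]]] or
   [s0 [s1 [ ... [sn [1]] ... ]]] with [s1, ..., sn] nonempty: its shape is
   [(s0, [:: s1; ...; sn], whether it ends in [1])]. *)
Fixpoint shape u : seq Y * seq (seq Y) * bool :=
  let: Raw s a := u in
  if a is t :: _ then
    if t == raw_one then (s, [::], true)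
    else let: (s', l, e) := shape t in (s, s' :: l, e)
  else (s, [::], false).

(** Here the exclusion of [[[u]]] acts: the argument of a bracket in an irreducible word is [1] or
    has an outer letter, and in the latter case its signal vanishes on the left. *)
Lemma raw_letters0 u : irr u -> ~~ is_op u -> (shape u).1.1 = [::] -> u = raw_one.
Proof.
case: u => [s [|t [|t' a]]] //=; first by move=> _ _ ->.
case: (t == _) => //=; first by move=> _ + s0; rewrite s0.
by case: (shape t) => [[s' l] e] /= _ + s0; rewrite s0.
Qed.

Lemma shape_inj u v : irr u -> irr v -> shape u = shape v -> u = v.
Proof.
elim/raw_ind': u v => s a /foldr_allP IHa [t b].
case: a IHa => [|x [|x' a]] IHa //; case: b => [|y [|y' b]] //=.
- by move=> _ _ [->].
- by case: (y == _) => //; case: (shape y) => [[? ?] ?].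
- by case: (x == _) => //; case: (shape x) => [[? ?] ?].
move=> /andP[irr_x _] /andP[irr_y _].
case: (x =P _) => [->|_]; case: (y =P _) => [->|_].
- by move=> [->].
- by case: (shape y) => [[? ?] ?].
- by case: (shape x) => [[? ?] ?].
have := IHa x (mem_head _ _) y irr_x irr_y.
case: (shape x) (shape y) => [[s1 l1] e1] [[s2 l2] e2] IH [-> s12 l12 e12].
by rewrite IH // s12 l12 e12.
Qed.

Lemma shape_nonempty u : irr u -> all (fun s => s != [::]) (shape u).1.2.
Proof.
elim/raw_ind': u => s a /foldr_allP IHa.
case: a IHa => [|x [|x' a]] IHa //= /andP[irr_x no_op].
have := raw_letters0 irr_x no_op; have := IHa x (mem_head _ _) irr_x.
case: (x =P _) => // x1; case: (shape x) => [[s1 l1] e1] /= -> s1P; rewrite andbT.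
by apply/eqP => /s1P.
Qed.

Lemma shape_sorted u : normal u -> sorted (@letter_ge d Y) (shape u).1.1 /\
  all (sorted (@letter_ge d Y)) (shape u).1.2.
Proof.
elim/raw_ind': u => s a /foldr_allP IHa /= /and3P[ss _ na].
case: a IHa na => [|x a] IHa; first by [].
case/andP=> nx _; rewrite /=; have [] := IHa x (mem_head _ _) nx.
by case: (x == _) => //; case: (shape x) => [[s1 l1] e1] /= -> ->.
Qed.

End WordShape.

(** * Signals of irreducible words and their leading monomials *)

Section WordsAsSignals.
Variables (k : fieldType) (lam : k) (d : Order.disp_t) (Y : orderType d).
Local Notation mono := {cmonom (Y * nat)%type}.
Variables (K : comAlgType k) (m : mono -> K).
Hypotheses (m_one : m mone = 1) (m_mul : forall a b, m (mmul a b) = m a * m b).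
Implicit Types (u v : raw Y).

Definition letter_signal (y : Y) : signal K :=
  fun t => if t.1.2 then m (ucm (y, t.1.1)) else 0.

Definition raw_signal u : signal K :=
  raw_eval *%R 1 (sig_op lam) letter_signal u.

(** Around a word with outer letters, the factor [- lam] of the operator meets the minus sign of the
    continuous part, giving [lam]. Around [1] no such sign occurs, since the constant is its own
    continuous part when [c] holds. *)
Fixpoint lam_factor u : k :=
  let: Raw _ a := u in
  if a is t :: _ then
    if t == raw_one Y then - lam else lam * lam_factor t
  else 1.

Lemma lam_factor_neq0 u : lam != 0 -> lam_factor u != 0.
Proof.
move=> lam0; elim/raw_ind': u => s a /foldr_allP IHa.
case: a IHa => [|x a] IHa /=; first exact: oner_neq0.
by case: ifP => _; rewrite ?oppr_eq0 // mulf_neq0 // IHa ?mem_head.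
Qed.

Definition shape_monomials u (n : nat) : seq mono :=
  map (mmul (timed (shape u).1.1 n)) (chains (shape u).1.2 n).

Lemma raw_signalE s a t : raw_signal (Raw s a) t =
  foldr *%R 1 (map (fun y => letter_signal y t) s) *
  foldr *%R 1 (map (fun x => sig_op lam (raw_signal x) t) a).
Proof.
rewrite /raw_signal /=; elim: s => [|y s IHs] /=; last by rewrite sigME IHs mulrA.
by rewrite mul1r; elim: a => //= x a IHa; rewrite sigME IHa.
Qed.

Lemma letters_signal_right s n c :
  foldr *%R 1 (map (fun y => letter_signal y (n, true, c)) s) = m (timed s n).
Proof. by elim: s => [|y s IHs] /=; rewrite ?m_one // IHs m_mul. Qed.

Lemma raw_signal_left s a n c : s != [::] -> raw_signal (Raw s a) (n, false, c) = 0.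
Proof.
by case: s => // y s _; rewrite raw_signalE /= /letter_signal /= !mul0r.
Qed.

Lemma sum_chains s l n :
  \sum_(a <- chains (s :: l) n) m a =
  \sum_(0 <= i < n) m (timed s i) * \sum_(a <- chains l i) m a.
Proof.
elim: n => [|n IHn]; first by rewrite big_geq // big_nil.
rewrite big_nat_recr // chainsS big_cat; congr (_ + _); first exact: IHn.
by rewrite big_map big_distrr; apply: eq_bigr => a _; apply: m_mul.
Qed.

Lemma raw_signal_right u n c : irr u ->
  raw_signal u (n, true, c) = (lam_factor u * ((shape u).2 ==> c)%:R) *:
    \sum_(a <- shape_monomials u n) m a.
Proof.
elim/raw_ind': u n => s a /foldr_allP IHa n irr_u.
have sE : (shape (Raw s a)).1.1 = s.
  by case: (a) => //= x b; case: (x == _) => //; case: (shape x) => [[? ?] ?].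
rewrite raw_signalE letters_signal_right /shape_monomials sE big_map {sE}.
under eq_bigr => b _ do rewrite m_mul.
rewrite -big_distrr /= scalerAr; congr (_ * _).
case: a IHa irr_u => [|x [|x' a]] // IHa.
  by rewrite /= big_seq1 m_one mul1r scale1r.
case/andP=> irr_x no_op; rewrite [LHS]mulr1.
have opE : sig_op lam (raw_signal x) (n, true, c) =
  - lam *: cont (raw_signal x) n c by [].
rewrite {}opE /=; case: (x =P raw_one Y) => [->|x1].
  (* The continuous part of the constant [1] is [1] or [0] according to [c]: this is the origin of
     the implication in the statement. *)
  rewrite big_seq1 m_one -scalerA; congr (_ *: _); elim: n => [|n IHn].
    by rewrite cont0; case: (c); rewrite ?scale1r ?scale0r.
  by rewrite contS IHn /raw_signal /= subrr addr0.
have x0 : (shape x).1.1 != [::] by apply/eqP => /(raw_letters0 irr_x no_op).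
have IHx i := IHa x (mem_head _ _) i irr_x.
have left0 i : raw_signal x (i, false, c) = 0.
  by case: (x) x0 => [[|y s'] b] h; rewrite ?raw_signal_left //; case: b h => //= z b;
    case: (z == _) => //; case: (shape z) => [[? ?] ?].
(* Only instants strictly before [n] enter, because the change leading to [n] starts on the right of
   its predecessor; this matches the strict inequalities in [chains]. *)
have -> : cont (raw_signal x) n c = - \sum_(0 <= i < n) raw_signal x (i, true, c).
  rewrite /cont left0 if_same add0r -sumrN; apply: eq_bigr => i _.
  by rewrite left0 sub0r.
rewrite scaleNr scalerN opprK; move: IHx; rewrite /shape_monomials.
case: (shape x) => [[s1 l1] e1] /= IHx; rewrite sum_chains !scaler_sumr.
apply: eq_bigr => i _; rewrite IHx scalerA -mulrA; congr (_ *: _).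
by rewrite big_map big_distrr; apply: eq_bigr => b _; apply: m_mul.
Qed.

Variable coef : mono -> {scalar K}.
Hypothesis coef_m : forall a b, coef a (m b) = (a == b)%:R.

(** Taken at the first instant at which the blocks of [u] admit a chain, where that chain is
    unique. *)
Definition leading_monomial u : mono :=
  mmul (timed (shape u).1.1 (size (shape u).1.2)) (top_chain (shape u).1.2).

Lemma coef_raw_signal u v c : irr u -> irr v -> normal u -> normal v ->
  coef (leading_monomial u) (raw_signal v (size (shape u).1.2, true, c)) =
  lam_factor v * ((shape v).2 ==> c)%:R * ((shape u).1 == (shape v).1)%:R.
Proof.
move=> irr_u irr_v nu nv; rewrite raw_signal_right // linearZ linear_sum /=.
congr (_ * _); under eq_bigr => a _ do rewrite coef_m.
rewrite -natr_sum; congr (_%:R).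
have := shape_nonempty irr_u; have := shape_nonempty irr_v.
have [] := shape_sorted nu; have [] := shape_sorted nv.
rewrite /leading_monomial /shape_monomials.
case: (shape u) (shape v) => [[s r] e] [[t l] f] /= st sl ss sr l0 r0.
set T := mmul _ _; rewrite big_map.
transitivity (count (fun a => mmul (timed t (size r)) a == T) (chains l (size r))).
  rewrite -sum1_count [RHS]big_mkcond; apply: eq_bigr => a _.
  by rewrite eq_sym; case: eqP.
rewrite xpair_eqE; have -> : ((s == t) && (r == l) : nat) = ((s == t) * (r == l))%N.
  by case: (s == t); rewrite ?mul1n.
rewrite [r == l]eq_sym -(count_chains l0 r0 sl sr).
have belowT a : a \in chains l (size r) ->
    (mmul (timed t (size r)) a == T) = (t == s) && (a == top_chain r).
  move=> al; apply: timed_mul_eq => // y; first exact: chains_below al _.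
  exact: top_chain_below.
rewrite (eq_in_count belowT) [s == t]eq_sym; case: (t == s); first by rewrite mul1n.
by rewrite mul0n -(count_pred0 (chains l (size r))); apply: eq_count.
Qed.

Hypothesis lam_neq0 : lam != 0.

(** At the leading monomial of [u] only words with the same letter blocks contribute, hence at most
    two: with and without a final [[1]]. For [c] false only the latter is seen, for [c] true both
    are, so the difference of the two readings isolates the former. *)
Lemma raw_signal_free (s : seq (raw Y)) (a : raw Y -> k) : uniq s ->
  {in s, forall u, irr u && normal u} ->
  \sum_(u <- s) a u *: raw_signal u = 0 -> {in s, forall u, a u = 0}.
Proof.
move=> s_uniq sP sum0 u us; have /andP[irr_u nu] := sP u us.
pose F c := \sum_(v <- s) a v * (lam_factor v * ((shape v).2 ==> c)%:R *
  ((shape u).1 == (shape v).1)%:R).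
have F0 c : F c = 0.
  transitivity (coef (leading_monomial u)
      ((\sum_(v <- s) a v *: raw_signal v) (size (shape u).1.2, true, c))).
    rewrite sig_sumE linear_sum /F !big_seq; apply: eq_bigr => v vs.
    have /andP[irr_v nv] := sP v vs.
    by rewrite sigZE linearZ coef_raw_signal.
  by rewrite sum0 linear0.
have : a u * lam_factor u = F (shape u).2 - (if (shape u).2 then F false else 0).
  rewrite /F; transitivity (\sum_(v <- s) if v == u then a v * lam_factor v else 0).
    by rewrite -big_mkcond -big_filter filter_pred1_uniq // big_seq1.
  have shapeP v : v \in s ->
      (v == u) = ((shape u).1 == (shape v).1) && ((shape v).2 == (shape u).2).
    move=> vs; have /andP[irr_v _] := sP v vs.
    apply/eqP/andP => [->//|[/eqP E1 /eqP E2]]; apply: shape_inj => //.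
    by rewrite [LHS]surjective_pairing [RHS]surjective_pairing E1 E2.
  case: (shape u).2 shapeP => shapeP; rewrite ?subr0 -?sumrB !big_seq;
    apply: eq_bigr => v vs; rewrite shapeP //;
    case: eqP => _; case: (shape v).2 => /=; rewrite ?mulr1 ?mulr0 ?subr0 ?subrr //.
rewrite !F0 if_same subrr => /eqP; rewrite mulf_eq0 (negbTE (lam_factor_neq0 u lam_neq0)).
by rewrite orbF => /eqP.
Qed.

End WordsAsSignals.

(** * Linear independence of the irreducible words *)

Section Independence.
Variables (k : fieldType) (lam : k) (d : Order.disp_t) (Y : orderType d).
Hypothesis lam_neq0 : lam != 0.
Local Notation mono := {cmonom (Y * nat)%type}.

Lemma mcoeff_scalar (a : mono) : scalar (@mcoeff mono k a).
Proof. by move=> c f g; rewrite mcoeffD mcoeffZ. Qed.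

(** The witness is the polynomial algebra in the variables [(y, n)]; the existential form exposes
    only its monomials and their coefficients. *)
Lemma timed_monomials_exist : exists (K : comAlgType k) (m : mono -> K)
    (coef : mono -> {scalar K}),
  [/\ m mone = 1, forall a b, m (mmul a b) = m a * m b &
      forall a b, coef a (m b) = (a == b)%:R].
Proof.
pose coef a := GRing.isLinear.Build k {malg k[mono]} k *%R (mcoeff a) (mcoeff_scalar a).
pose coefL a : {scalar {malg k[mono]}} := HB.pack (mcoeff a) (coef a).
exists {malg k[mono]}, (fun a => << a >>), coefL; split=> // a b.
  by apply/esym; rewrite malgM_def fgmulUU mulr1.
by rewrite eq_sym; apply: mcoeffU1.
Qed.

Lemma irr_words_free (F : comAlgType k) (P : {linear F -> F}) (i : Y -> F)
    (s : seq (word Y)) (a : word Y -> k) :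
  free_qiRB lam P i -> uniq s -> {in s, forall w, Irr_rb w} ->
  \sum_(w <- s) a w *: eval P i w = 0 -> {in s, forall w, a w = 0}.
Proof.
move=> [_ univ] s_uniq sP sum0.
have [K [m [coef [m1 mM coefE]]]] := timed_monomials_exist.
have [h [hP _]] := univ (signal K) _ (letter_signal m) (sig_op_qiRB K lam).
(* [raw_signal_free] speaks of raw words, so the coefficients are extended by zero to those that are
   not normal. *)
pose b u := if insub u is Some w then a w else 0.
have bE (w : word Y) : b (wval w) = a w by rewrite /b valK.
move=> w ws; rewrite -bE.
apply: (raw_signal_free m1 mM coefE lam_neq0 (s := map val s)) (map_f _ ws).
- by rewrite map_inj_uniq //; apply: val_inj.
- by move=> _ /mapP[v vs ->]; rewrite (valP v) andbT; apply/Irr_rbE/sP.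
rewrite big_map; transitivity (h (\sum_(w <- s) a w *: eval P i w)).
  rewrite linear_sum; apply: eq_bigr => v _.
  by rewrite linearZ bE; congr (_ *: _); apply: esym (extends_hom_eval v hP).
by rewrite sum0 linear0.
Qed.

End Independence.

Theorem theorem4p2 (k : fieldType) (lam : k) (d : Order.disp_t) (Y : orderType d)
    (k_char0 : [pchar k] =i pred0) (lam_neq0 : lam != 0)
    (Y_wo : well_order (fun x y : Y => (x <= y)%O)) :
  monomial_order (@cdb_le d Y) /\
  GS_basis (@cdb_le d Y) (@S_rb k lam d Y) /\
  (exists (F : comAlgType k) (P : {linear F -> F}) (i : Y -> F),
     free_qiRB lam P i) /\
  (forall (F : comAlgType k) (P : {linear F -> F}) (i : Y -> F),
     free_qiRB lam P i ->
     linear_basis (@Irr_rb d Y) (fun w : word Y => canonical_hom P i << w >>)).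
Proof.
split; first by split; [apply: cdb_well_order | move=> q u v; apply: wsubst_le].
split; first exact: S_rb_GS_basis.
split; first by have [F [P [i [freeF _]]]] := free_qiRB_exists lam Y; exists F, P, i.
move=> F P i freeF; split=> [s c s_uniq sP sum0|]; last exact: free_qiRB_spanning freeF.
apply: (irr_words_free lam_neq0 freeF s_uniq sP); rewrite -[RHS]sum0.
by apply: eq_bigr => w _; congr (_ *: _); apply: esym (canonical_homU P i w).
Qed.
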